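(* The algebra $M_{4B}$ is $7$-dimensional. It has basis $\{a_1,a_{-1},a_2,a_{-2},a_3,a_{-3},a_\rho\}$, where $a_\rho := a_1+a_{-1}-8\,a_1\cdot a_{-1}$, and its coefficient ring $R_{4B}$ is equal to $\mathbb{R}$.
   Context: Algebras are commutative but not necessarily associative, over a commutative ring $R$ with $1$ containing $\mathbb{R}$ as a subfield. For an idempotent $a\in V$ and $\lambda\in R$ put $V_\lambda^{(a)}=\{v\in V: a\cdot v=\lambda v\}$, and for $\Lambda\subseteq R$ put $V_\Lambda^{(a)}=\bigoplus_{\lambda\in\Lambda}V_\lambda^{(a)}$ ($V_\emptyset^{(a)}=0$). The Monster fusion rule $(\mathcal{M},* )$ has $\mathcal{M}=\{1,0,\frac14,\frac1{32}\}$ and symmetric $*$ with $1*1=\{1\}$, $1*0=\emptyset$, $0*0=\{0\}$, $1*\frac14=0*\frac14=\{\frac14\}$, $\frac14*\frac14=\{1,0\}$, $\lambda*\frac1{32}=\{\frac1{32}\}$ for $\lambda\in\{1,0,\frac14\}$, $\frac1{32}*\frac1{32}=\{1,0,\frac14\}$. An idempotent $a$ is an $(\mathcal{M},* )$-axis if $V=\bigoplus_{\lambda\in\mathcal{M}}V_\lambda^{(a)}$ and $V_\lambda^{(a)}\cdot V_\mu^{(a)}\subseteq V_{\lambda*\mu}^{(a)}$ for all $\lambda,\mu\in\mathcal{M}$; it is primitive if $V_1^{(a)}=Ra$. A primitive Frobenius $(\mathcal{M},* )$-axial algebra is an algebra generated by a set $A$ of primitive $(\mathcal{M},* )$-axes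 with a Frobenius form, i.e. a nonzero $R$-bilinear form $\langle\,,\rangle$ with $\langle u,v\cdot w\rangle=\langle u\cdot v,w\rangle$, normalised by $\langle a,a\rangle=1$ for axes $a\in A$. The Miyamoto involution $\tau(a)$ acts as $1$ on $V_1^{(a)}\oplus V_0^{(a)}\oplus V_{1/4}^{(a)}$ and as $-1$ on $V_{1/32}^{(a)}$. Property $\mathcal{P}$: $A=\{a_1,a_{-1},a_2,a_{-2},a_3,a_{-3}\}$ and on $A$, $\tau(a_1)=\tau(a_{-1})=(a_2,a_{-2})(a_3,a_{-3})$, $\tau(a_2)=\tau(a_{-2})=(a_1,a_{-1})(a_3,a_{-3})$, $\tau(a_3)=\tau(a_{-3})=(a_1,a_{-1})(a_2,a_{-2})$. Shape $4B$: for all distinct $i,j\in\{1,2,3\}$ the subalgebra $\langle\langle a_i,a_j\rangle\rangle$ generated by $a_i,a_j$ is of type $4B$, i.e. it is spanned by $a_{\pm i},a_{\pm j}$ and a further idempotent $a_{\rho}$ (depending a priori on $\{i,j\}$) such that, for all signs $\epsilon,\delta$ and for $k\in\{i,j\}$: $a_{\epsilon i}\cdot a_{\delta j}=\frac1{64}(a_{\epsilon i}+a_{\delta j}-a_{-\epsilon i}-a_{-\delta j}+a_\rho)$, $a_k\cdot a_{-k}=\frac18(a_k+a_{-k}-a_\rho)$, $a_{\epsilon k}\cdot a_\rho=\frac18(a_{\epsilon k}+a_\rho-a_{-\epsilon k})$, $\langle a_{\epsilon i},a_{\delta j}\rangle=\frac1{64}$, $\langle a_k,a_{-k}\rangle=\langle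 a_{\epsilon k},a_\rho\rangle=\frac18$, $\langle a_\rho,a_\rho\rangle=1$. Universal algebra: let $\hat X$ be the free commutative non-associative magma on $\hat a_{\pm1},\hat a_{\pm2},\hat a_{\pm3}$; let $\sim$ be the equivalence relation on $\hat X\times\hat X$ generated by $(\hat x\cdot\hat y,\hat z)\sim(\hat x,\hat y\cdot\hat z)$; let $\hat R=\mathbb{R}[\lambda_{[\hat x,\hat y]}]$ be the polynomial ring with one indeterminate for each $\sim$-class; let $\hat M=\hat R\hat X$ be the algebra of formal $\hat R$-linear combinations of elements of $\hat X$, with $\hat R$-bilinear form $\langle\hat x,\hat y\rangle=\lambda_{[\hat x,\hat y]}$. For ideals $I$ of $\hat M$ and $J\ne\hat R$ of $\hat R$ with $J\hat M\subseteq I$ and $\langle I,\hat M\rangle\subseteq J$, the quotient $\hat M/I$ is an algebra with form over its coefficient ring $\hat R/J$, with marked generators $a_{\pm i}$ the images of $\hat a_{\pm i}$. Let $\mathcal{C}_{4B}$ be the class of such quotients which are primitive Frobenius $(\mathcal{M},* )$-axial algebras (with axes the marked generators) satisfying property $\mathcal{P}$ and having shape $4B$. $M_{4B}$ denotes the universal member of $\mathcal{C}_{4B}$ (given by the smallest pair $(I,J)$; all members of $\mathcal{C}_{4B}$ are quotients of it), and $R_{4B}=\hat R/J$ its coefficient ring. *)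

(* Defs.v *)
From HB Require Import structures.
From mathcomp Require Import all_boot all_order all_algebra.
From mathcomp Require Import finmap monalg.
From mathcomp Require Import boolp classical_sets reals.

Set Implicit Arguments.
Unset Strict Implicit.
Unset Printing Implicit Defensive.

Import GRing.Theory.
Local Open Scope classical_set_scope.
Local Open Scope ring_scope.
Local Open Scope quotient_scope.

Record formAlg (S : comNzRingType) := FormAlg {
  fa_sort :> lmodType S;
  amul : fa_sort -> fa_sort -> fa_sort;
  aform : fa_sort -> fa_sort -> S;
  amulC : commutative amul;
  amul_linear : forall (c : S) (u v w : fa_sort),
    amul (c *: u + v) w = c *: amul u w + amul v w;
  aform_linearl : forall (c : S) (u v w : fa_sort),
    aform (c *: u + v) w = c * aform u w + aform v w;
  aform_linearr : forall (c : S) (u v w : fa_sort),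
    aform u (c *: v + w) = c * aform u v + aform u w
}.

Arguments amul {S f}.
Arguments aform {S f}.

Section FormAlgebras.
Variables (S : comNzRingType) (V : formAlg S).

Definition is_subalgebra (B : set V) : Prop :=
  [/\ B 0,
      forall (c : S) u v, B u -> B v -> B (c *: u + v)
    & forall u v, B u -> B v -> B (amul u v)].

Definition gen_subalgebra (A : set V) : set V :=
  [set v | forall B : set V, is_subalgebra B -> A `<=` B -> B v].

Definition span_of n (b : n.-tuple V) : set V :=
  [set v | exists c : 'I_n -> S, v = \sum_(i < n) c i *: tnth b i].

Definition is_basis n (b : n.-tuple V) : Prop :=
  span_of b = setT /\
  forall c : 'I_n -> S, \sum_(i < n) c i *: tnth b i = 0 -> forall i, c i = 0.

Definition is_frobenius_form : Prop :=
  (exists u v : V, aform u v != 0) /\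
  forall u v w : V, aform u (amul v w) = aform (amul u v) w.

End FormAlgebras.

Section Quotient.
Variables (K : comNzRingType) (A : formAlg K).

(** Both inclusions <I, A> <= J and <A, I> <= J are required, as the form is
    not assumed symmetric.  Properness of [J] is part of [idealr]. *)
Record ideal_pair := IdealPair {
  idJ : idealr K;
  idI : zmodClosed A;
  idI_scale : forall (c : K) (v : A), v \in idI -> c *: v \in idI;
  idI_mul : forall u v : A, v \in idI -> amul u v \in idI;
  idJI : forall (c : K) (v : A), c \in idJ -> c *: v \in idI;
  idI_forml : forall u v : A, u \in idI -> aform u v \in idJ;
  idI_formr : forall u v : A, v \in idI -> aform u v \in idJ
}.

Variable p : ideal_pair.

Definition Rquot : comNzRingType := {ideal_quot (idJ p)}.

Definition Mquot := {ideal_quot (idI p)}.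
HB.instance Definition _ := GRing.Zmodule.on Mquot.

Definition piR (c : K) : Rquot := \pi_{ideal_quot (idJ p)} c.
Definition piM (v : A) : Mquot := \pi_{ideal_quot (idI p)} v.

Lemma piR_eq c d : (piR c = piR d) <-> (c - d \in idJ p).
Proof. by rewrite /piR Quotient.idealrBE; split=> /eqP. Qed.

Lemma piM_eq u v : (piM u = piM v) <-> (u - v \in idI p).
Proof. by rewrite /piM Quotient.idealrBE; split=> /eqP. Qed.

Lemma piR_repr (c : Rquot) : piR (repr c) = c.
Proof. exact: reprK. Qed.

Lemma piM_repr (v : Mquot) : piM (repr v) = v.
Proof. exact: reprK. Qed.

Lemma piRD c d : piR (c + d) = piR c + piR d.
Proof. exact: (rmorphD (\pi_{ideal_quot (idJ p)})). Qed.

Lemma piRM c d : piR (c * d) = piR c * piR d.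
Proof. exact: (rmorphM (\pi_{ideal_quot (idJ p)})). Qed.

Lemma piMD u v : piM (u + v) = piM u + piM v.
Proof. exact: (raddfD (\pi_{ideal_quot (idI p)})). Qed.

Definition scaleq (c : Rquot) (v : Mquot) : Mquot := piM (repr c *: repr v).
Definition mulq (u v : Mquot) : Mquot := piM (amul (repr u) (repr v)).
Definition formq (u v : Mquot) : Rquot := piR (aform (repr u) (repr v)).

Lemma scaleqE c v : scaleq (piR c) (piM v) = piM (c *: v).
Proof.
apply/piM_eq; set c' := repr _; set v' := repr _.
have cc : c' - c \in idJ p by apply/piR_eq; rewrite piR_repr.
have vv : v' - v \in idI p by apply/piM_eq; rewrite piM_repr.
have -> : c' *: v' - c *: v = (c' - c) *: v' + c *: (v' - v).
  by rewrite scalerBl scalerBr addrA subrK.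
by apply: rpredD; [exact: idJI | exact: idI_scale].
Qed.

Lemma amulDr (u v w : A) : amul u (v + w) = amul u v + amul u w.
Proof.
by rewrite !(amulC u); have := amul_linear 1 v w u; rewrite !scale1r.
Qed.

Lemma mulqE u v : mulq (piM u) (piM v) = piM (amul u v).
Proof.
apply/piM_eq; set u' := repr _; set v' := repr _.
have uu : u' - u \in idI p by apply/piM_eq; rewrite piM_repr.
have vv : v' - v \in idI p by apply/piM_eq; rewrite piM_repr.
have -> : amul u' v' - amul u v =
    amul v' (u' - u) + amul u (v' - v).
  apply/eqP; rewrite subr_eq -addrA -amulDr subrK (amulC u).
  by rewrite -amulDr subrK amulC.
by apply: rpredD; exact: idI_mul.
Qed.

Lemma formqE u v : formq (piM u) (piM v) = piR (aform u v).
Proof.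
apply/piR_eq; set u' := repr _; set v' := repr _.
have uu : u' - u \in idI p by apply/piM_eq; rewrite piM_repr.
have vv : v' - v \in idI p by apply/piM_eq; rewrite piM_repr.
have -> : aform u' v' - aform u v =
    aform (u' - u) v' + aform u (v' - v).
  have := aform_linearl 1 (u' - u) u v'.
  have := aform_linearr 1 u (v' - v) v.
  rewrite !scale1r !mul1r !subrK => -> ->.
  by rewrite addrA addrK.
by apply: rpredD; [exact: idI_forml | exact: idI_formr].
Qed.

Lemma scaleqA c d v : scaleq c (scaleq d v) = scaleq (c * d) v.
Proof.
rewrite -[c]piR_repr -[d]piR_repr -[v]piM_repr -piRM !scaleqE.
by rewrite scalerA.
Qed.

Lemma scaleq1 : left_id 1 scaleq.
Proof.
move=> v; have -> : (1 : Rquot) = piR 1.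
  by rewrite /piR (rmorph1 (\pi_{ideal_quot (idJ p)})).
by rewrite -[v]piM_repr scaleqE scale1r.
Qed.

Lemma scaleqDr : right_distributive scaleq +%R.
Proof.
move=> c u v; rewrite -[c]piR_repr -[u]piM_repr -[v]piM_repr -piMD !scaleqE.
by rewrite scalerDr piMD.
Qed.

Lemma scaleqDl v : {morph scaleq^~ v : c d / c + d}.
Proof.
move=> c d; rewrite -[c]piR_repr -[d]piR_repr -[v]piM_repr -piRD !scaleqE.
by rewrite scalerDl piMD.
Qed.

HB.instance Definition _ := GRing.Zmodule_isLmodule.Build Rquot Mquot
  scaleqA scaleq1 scaleqDr scaleqDl.

Lemma piMZ c v : piM (c *: v) = piR c *: piM v.
Proof. by rewrite -scaleqE. Qed.

Lemma mulqC : commutative mulq.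
Proof. by move=> u v; rewrite /mulq amulC. Qed.

Lemma mulq_linear (c : Rquot) (u v w : Mquot) :
  mulq (c *: u + v) w = c *: mulq u w + mulq v w.
Proof.
rewrite -[c]piR_repr -[u]piM_repr -[v]piM_repr -[w]piM_repr.
by rewrite -piMZ -piMD !mulqE amul_linear piMD piMZ.
Qed.

Lemma formq_linearl (c : Rquot) (u v w : Mquot) :
  formq (c *: u + v) w = c * formq u w + formq v w.
Proof.
rewrite -[c]piR_repr -[u]piM_repr -[v]piM_repr -[w]piM_repr.
by rewrite -piMZ -piMD !formqE aform_linearl piRD piRM.
Qed.

Lemma formq_linearr (c : Rquot) (u v w : Mquot) :
  formq u (c *: v + w) = c * formq u v + formq u w.
Proof.
rewrite -[c]piR_repr -[u]piM_repr -[v]piM_repr -[w]piM_repr.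
by rewrite -piMZ -piMD !formqE aform_linearr piRD piRM.
Qed.

Definition quot_alg : formAlg Rquot :=
  FormAlg mulqC mulq_linear formq_linearl formq_linearr.

End Quotient.

(** [M1], [M0], [M4], [M32] stand for the eigenvalues 1, 0, 1/4, 1/32. *)
Inductive monster := M1 | M0 | M4 | M32.

Definition monster_eq_dec (x y : monster) : {x = y} + {x <> y}.
Proof. by decide equality. Defined.

HB.instance Definition _ := hasDecEq.Build monster (compareP monster_eq_dec).

Definition monsters : seq monster := [:: M1; M0; M4; M32].

Definition fusion (l m : monster) : seq monster :=
  match l, m with
  | M1, M1 => [:: M1]
  | M1, M0 | M0, M1 => [::]
  | M0, M0 => [:: M0]
  | M1, M4 | M4, M1 | M0, M4 | M4, M0 => [:: M4]
  | M4, M4 => [:: M1; M0]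
  | M32, M32 => [:: M1; M0; M4]
  | _, M32 | M32, _ => [:: M32]
  end.

Definition monster_val (R : realType) (l : monster) : R :=
  match l with M1 => 1 | M0 => 0 | M4 => 4^-1 | M32 => 32^-1 end.

(** The coefficient ring [S] contains the reals through [iota], which is
    automatically injective as [S] is nontrivial. *)

Section Axes.
Variables (R : realType) (S : comNzRingType) (iota : {rmorphism R -> S}).
Variable V : formAlg S.

Definition eigsp (a : V) (l : monster) : set V :=
  [set v | amul a v = iota (monster_val R l) *: v].

(** The sum of the eigenspaces of [a] with label in [L]. *)
Definition eigsum (a : V) (L : seq monster) : set V :=
  [set v | exists u : monster -> V,
     (forall l, l \in L -> eigsp a l (u l)) /\ v = \sum_(l <- L) u l].

Definition is_axis (a : V) : Prop :=
  [/\ amul a a = a,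
      eigsum a monsters = setT,
      forall u : monster -> V, (forall l, eigsp a l (u l)) ->
        \sum_(l <- monsters) u l = 0 -> forall l, u l = 0
    & forall l m v w, eigsp a l v -> eigsp a m w ->
        eigsum a (fusion l m) (amul v w)].

Definition is_primitive (a : V) : Prop :=
  eigsp a M1 = [set v | exists c : S, v = c *: a].

(** When [a] is an axis, the set below is a singleton. *)
Definition miyamoto (a v : V) : V :=
  xget 0 [set w | exists vp vm, [/\ eigsum a [:: M1; M0; M4] vp,
     eigsum a [:: M32] vm, v = vp + vm & w = vp - vm]].

End Axes.

(** [(true, i)] and [(false, i)] index a_(i+1) and a_-(i+1), for i = 0, 1, 2. *)

Definition idx : finType := (bool * 'I_3)%type.

Definition opp_idx (t : idx) : idx := (~~ t.1, t.2).

Section MarkedAlgebras.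
Variables (R : realType) (S : comNzRingType) (iota : {rmorphism R -> S}).
Variables (V : formAlg S) (a : idx -> V).

Definition is_primitive_frobenius_axial : Prop :=
  [/\ forall t, is_axis iota (a t) /\ is_primitive iota (a t),
      gen_subalgebra (range a) = setT,
      is_frobenius_form V
    & forall t, aform (a t) (a t) = 1].

Definition propertyP : Prop :=
  injective a /\
  forall s t : idx,
    miyamoto iota (a s) (a t) = a (if t.2 == s.2 then t else opp_idx t).

Definition type4B (i j : 'I_3) : Prop :=
  exists rho : V,
    [/\ amul rho rho = rho,
        gen_subalgebra [set a (true, i); a (true, j)] =
          span_of [tuple a (true, i); a (false, i);
                         a (true, j); a (false, j); rho],
        forall e d : bool,
          amul (a (e, i)) (a (d, j)) =
            iota 64^-1 *: (a (e, i) + a (d, j) - a (~~ e, i) - a (~~ d, j) + rho)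
          /\ aform (a (e, i)) (a (d, j)) = iota 64^-1,
        forall k : 'I_3, k = i \/ k = j ->
          [/\ amul (a (true, k)) (a (false, k)) =
                iota 8^-1 *: (a (true, k) + a (false, k) - rho),
              aform (a (true, k)) (a (false, k)) = iota 8^-1
            & forall e : bool,
                amul (a (e, k)) rho =
                  iota 8^-1 *: (a (e, k) + rho - a (~~ e, k))
                /\ aform (a (e, k)) rho = iota 8^-1]
      & aform rho rho = 1].

Definition shape4B : Prop := forall i j : 'I_3, i != j -> type4B i j.

End MarkedAlgebras.

Inductive tree := Leaf of idx | Node of tree & tree.

HB.instance Definition _ := gen_eqMixin tree.
HB.instance Definition _ := gen_choiceMixin tree.

Inductive tree_comm : tree -> tree -> Prop :=
| tree_comm_refl t : tree_comm t t
| tree_comm_sym t u : tree_comm t u -> tree_comm u t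
| tree_comm_trans t u v : tree_comm t u -> tree_comm u v -> tree_comm t v
| tree_comm_swap t u : tree_comm (Node t u) (Node u t)
| tree_comm_node t t' u u' :
    tree_comm t t' -> tree_comm u u' -> tree_comm (Node t u) (Node t' u').

Definition tree_commb (t u : tree) : bool := `[< tree_comm t u >].

Lemma tree_commb_equiv : equiv_class_of tree_commb.
Proof.
split=> [t|t u|u t v].
- exact/asboolP/tree_comm_refl.
- by apply/asboolP/asboolP; exact: tree_comm_sym.
- by move=> /asboolP tu /asboolP uv; apply/asboolP; exact: tree_comm_trans tu uv.
Qed.

Canonical tree_comm_equiv := EquivRelPack tree_commb_equiv.
Canonical tree_comm_encModRel := defaultEncModRel tree_commb.

Definition magma := {eq_quot tree_commb}.

Definition xgen (t : idx) : magma := \pi_magma (Leaf t).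
Definition xmul (x y : magma) : magma := \pi_magma (Node (repr x) (repr y)).

Lemma xmulC : commutative xmul.
Proof.
by move=> x y; apply/eqP; rewrite eqmodE; apply/asboolP/tree_comm_swap.
Qed.

Inductive assoc_rel : magma * magma -> magma * magma -> Prop :=
| assoc_refl p : assoc_rel p p
| assoc_sym p q : assoc_rel p q -> assoc_rel q p
| assoc_trans p q r : assoc_rel p q -> assoc_rel q r -> assoc_rel p r
| assoc_base x y z : assoc_rel (xmul x y, z) (x, xmul y z).

Definition assoc_relb (p q : magma * magma) : bool := `[< assoc_rel p q >].

Lemma assoc_relb_equiv : equiv_class_of assoc_relb.
Proof.
split=> [p|p q|q p r].
- exact/asboolP/assoc_refl.
- by apply/asboolP/asboolP; exact: assoc_sym.
- by move=> /asboolP pq /asboolP qr; apply/asboolP; exact: assoc_trans pq qr.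
Qed.

Canonical assoc_equiv := EquivRelPack assoc_relb_equiv.
Canonical assoc_encModRel := defaultEncModRel assoc_relb.

Definition indet := {eq_quot assoc_relb}.

(** Polynomials with real coefficients and indeterminates in [indet]. *)
Definition Rhat (R : realType) : comNzRingType := {malg R[{cmonom indet}]}.

Definition lam (R : realType) (x y : magma) : Rhat R :=
  << ucm (\pi_indet (x, y)) >>.

Section BilinearExtension.
Variables (K : choiceType) (S : comNzRingType) (W : lmodType S).

Definition bilext (h : K -> K -> W) (u v : {malg S[K]}) : W :=
  \sum_(x <- msupp u) \sum_(y <- msupp v) (u@_x * v@_y) *: h x y.

Definition linext (h : K -> W) (u : {malg S[K]}) : W :=
  \sum_(x <- msupp u) u@_x *: h x.

Lemma linextEw (h : K -> W) (D : {fset K}) u :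
  (msupp u `<=` D)%fset -> linext h u = \sum_(x <- D) u@_x *: h x.
Proof.
move=> sD; rewrite /linext; apply: big_fset_incl => // x _ /mcoeff_outdom ->.
by rewrite scale0r.
Qed.

Lemma linext_linear (h : K -> W) (c : S) u v :
  linext h (c *: u + v) = c *: linext h u + linext h v.
Proof.
set D := (msupp (c *: u + v) `|` (msupp u `|` msupp v))%fset.
rewrite !(@linextEw h D) /D ?fsubsetUl //; last 2 first.
- by rewrite (fsubset_trans (fsubsetUr _ _) (fsubsetUr _ _)).
- by rewrite (fsubset_trans (fsubsetUl _ _) (fsubsetUr _ _)).
rewrite scaler_sumr -big_split /=; apply: eq_bigr => x _.
by rewrite mcoeffD mcoeffZ scalerDl scalerA.
Qed.

Lemma bilextE (h : K -> K -> W) u v :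
  bilext h u v = linext (fun x => linext (h x) v) u.
Proof.
rewrite /bilext /linext; apply: eq_bigr => x _; rewrite scaler_sumr.
by apply: eq_bigr => y _; rewrite scalerA.
Qed.

Lemma bilextT (h : K -> K -> W) u v :
  bilext h u v = bilext (fun x y => h y x) v u.
Proof.
rewrite /bilext exchange_big; apply: eq_bigr => x _.
by apply: eq_bigr => y _; rewrite mulrC.
Qed.

Lemma bilext_linearl (h : K -> K -> W) (c : S) u v w :
  bilext h (c *: u + v) w = c *: bilext h u w + bilext h v w.
Proof. by rewrite !bilextE linext_linear. Qed.

Lemma bilext_linearr (h : K -> K -> W) (c : S) u v w :
  bilext h u (c *: v + w) = c *: bilext h u v + bilext h u w.
Proof. by rewrite !(bilextT h) bilext_linearl. Qed.

End BilinearExtension.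

Section Universal.
Variable R : realType.

Definition mmulhat : {malg (Rhat R)[magma]} -> {malg (Rhat R)[magma]} ->
    {malg (Rhat R)[magma]} :=
  bilext (fun x y => << xmul x y >>).

Definition formhat : {malg (Rhat R)[magma]} -> {malg (Rhat R)[magma]} -> Rhat R :=
  bilext (W := (Rhat R)^o) (lam R).

Lemma mmulhatC : commutative mmulhat.
Proof.
move=> u v; rewrite /mmulhat.
have hC : (fun x y => << xmul x y >>) = (fun x y => << xmul y x >>)
    :> (magma -> magma -> {malg (Rhat R)[magma]}).
  by apply/funext => x; apply/funext => y; rewrite xmulC.
by rewrite [in RHS]hC; exact: bilextT.
Qed.

Lemma mmulhat_linear (c : Rhat R) u v w :
  mmulhat (c *: u + v) w = c *: mmulhat u w + mmulhat v w.
Proof. exact: bilext_linearl. Qed.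

Lemma formhat_linearl (c : Rhat R) u v w :
  formhat (c *: u + v) w = c * formhat u w + formhat v w.
Proof. exact: (@bilext_linearl _ _ (Rhat R)^o). Qed.

Lemma formhat_linearr (c : Rhat R) u v w :
  formhat u (c *: v + w) = c * formhat u v + formhat u w.
Proof. exact: (@bilext_linearr _ _ (Rhat R)^o). Qed.

Definition Mhat : formAlg (Rhat R) :=
  FormAlg mmulhatC mmulhat_linear formhat_linearl formhat_linearr.

Definition malgC_Rhat : {rmorphism R -> Rhat R} := @malgC {cmonom indet} R.

Section Pair.
Variable p : ideal_pair Mhat.

Definition iotaq : {rmorphism R -> Rquot p} :=
  \pi_{ideal_quot (idJ p)} \o malgC_Rhat.

Definition gen (t : idx) : quot_alg p := piM p (<< xgen t >> : Mhat).

Definition in_C4B : Prop :=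
  [/\ is_primitive_frobenius_axial iotaq gen,
      propertyP iotaq gen
    & shape4B iotaq gen].

End Pair.

(** [p] is the smallest ideal pair whose quotient lies in the class; its
    quotient is M_4B and its coefficient ring is R_4B. *)
Definition is_universal_4B (p : ideal_pair Mhat) : Prop :=
  in_C4B p /\
  forall q : ideal_pair Mhat, in_C4B q ->
    {subset idI p <= idI q} /\ {subset idJ p <= idJ q}.

End Universal.

(* Main.v *)
(** In a member of the class every a_rho is a_i + a_-i - 8 a_i a_-i for each of
    its two indices, so the three of them coincide; the products and the form
    of the six axes and this a_rho are then those of one fixed 7-dimensional
    real algebra W.  Sending generators to generators therefore maps W to every
    member of the class, and evaluating Mhat and Rhat in W shows that the
    quotient maps of Mhat and Rhat factor through W and the reals.  Conversely,
    W itself belongs to the class: the group permuting the indices and the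
    signs acts on the multiplication table, so it suffices to split W
    explicitly into the eigenspaces of one axis.  Hence the kernels of the two
    evaluations form the smallest ideal pair, with quotient W over the reals. *)

Require Import Defs.
From HB Require Import structures.
From mathcomp Require Import all_boot all_order all_algebra.
From mathcomp Require Import finmap monalg perm ring lra.
From mathcomp Require Import boolp classical_sets reals.

Set Implicit Arguments.
Unset Strict Implicit.
Unset Printing Implicit Defensive.

Import GRing.Theory Num.Theory.
Local Open Scope classical_set_scope.
Local Open Scope ring_scope.
Local Open Scope quotient_scope.

Local Notation "1" := (@mone _) : monom_scope.
Local Notation "x * y" := (mmul x y) : monom_scope.

Arguments amul {S f} _ _ : simpl never.
Arguments aform {S f} _ _ : simpl never.

(** * Algebras with a form *)

Lemma inj_surj_bij (T U : Type) (f : T -> U) :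
  injective f -> (forall y, exists x, f x = y) -> bijective f.
Proof.
move=> injf surjf; pose g y := sval (cid (surjf y)).
have gK : cancel g f by move=> y; rewrite /g; case: cid.
by exists g => // x; apply: injf; rewrite gK.
Qed.

(** The product is registered as linear in its second factor; sums in the first factor are reached
    through [amulC]. *)
HB.instance Definition _ (S : comNzRingType) (V : formAlg S) (u : V) :=
  GRing.isLinear.Build S V V *:%R (amul u)
    (fun c v w => etrans (amulC u (c *: v + w))
       (etrans (amul_linear c v w u)
          (congr2 (fun x y => c *: x + y) (amulC v u) (amulC w u)))).

HB.instance Definition _ (S : comNzRingType) (V : formAlg S) (u : V) :=
  GRing.isLinear.Build S V S *%R (aform u) (fun c => aform_linearr c u).

(** The form is not assumed symmetric, so linearity in its first argument needs a map of its own. *)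
Definition aform_op S (V : formAlg S) (v u : V) := aform u v.

HB.instance Definition _ (S : comNzRingType) (V : formAlg S) (v : V) :=
  GRing.isLinear.Build S V S *%R (aform_op v)
    (fun c u w => aform_linearl c u w v).

(** Semilinear along [iota], so that a real algebra can be mapped to a quotient over its own
    coefficient ring. *)
Record form_morphism (S S' : comNzRingType) (iota : {rmorphism S -> S'})
    (V : formAlg S) (V' : formAlg S') := FormMorphism {
  form_morphism_fun :> V -> V';
  form_morphism_linear : linear_for (iota \; *:%R) form_morphism_fun;
  form_morphismM : forall u v,
    form_morphism_fun (amul u v) =
      amul (form_morphism_fun u) (form_morphism_fun v);
  form_morphism_form : forall u v,
    aform (form_morphism_fun u) (form_morphism_fun v) = iota (aform u v)
}.

HB.instance Definition _ (S S' : comNzRingType) (iota : {rmorphism S -> S'})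
    (V : formAlg S) (V' : formAlg S') (f : form_morphism iota V V') :=
  GRing.isLinear.Build S V V' (iota \; *:%R) f (form_morphism_linear f).

HB.instance Definition _ (K : comNzRingType) (A : formAlg K)
    (p : ideal_pair A) :=
  GRing.RMorphism.copy (@piR _ _ p) (\pi_{ideal_quot (idJ p)}).

HB.instance Definition _ (K : comNzRingType) (A : formAlg K)
    (p : ideal_pair A) :=
  GRing.isLinear.Build K A (quot_alg p) (@piR _ _ p \; *:%R) (@piM _ _ p)
    (fun c u v => etrans (piMD p _ _) (congr1 (+%R^~ _) (piMZ p c u))).

(** * Evaluating the universal algebra in an algebra with Frobenius form *)

Section MonomialInduction.
Variable I : choiceType.

(** By induction on the degree: a monomial other than 1 contains some indeterminate, which can be
    divided out. *)
Lemma cmonom_ind (P : {cmonom I} -> Prop) :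
  P 1%M -> (forall i m, P m -> P (ucm i * m)%M) -> forall m, P m.
Proof.
move=> P1 PM m; have [n] := ubnP (mdeg m); elim: n m => // n IHn m ltmn.
have [->//|/eqP mn1] := eqVneq m 1%M.
have [i mi] : exists i, m i != 0%N.
  apply: contra_notP mn1 => m0; apply/eqP/cmP => i; rewrite cm1.
  by apply/eqP; apply: contra_notT m0 => mi; exists i.
have defm : m = (ucm i * divcm m (ucm i))%M.
  apply/eqP/cmP => j; rewrite cmM divcmE cmU.
  by case: eqVneq => [<-|_]; rewrite ?subn0 // subnKC // lt0n.
rewrite defm; apply/PM/IHn; move: ltmn.
by rewrite {1}defm mdegM mdegU add1n ltnS.
Qed.

Variables (S : comNzRingType) (v : I -> S).

Definition cmonom_eval (m : {cmonom I}) : S :=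
  \prod_(i <- finsupp m) v i ^+ m i.

Lemma cmonom_evalEw (D : {fset I}) (m : {cmonom I}) :
  (finsupp m `<=` D)%fset -> cmonom_eval m = \prod_(i <- D) v i ^+ m i.
Proof.
move=> sD; rewrite /cmonom_eval; apply: big_fset_incl => // i _.
by rewrite -cmE_neq0 negbK => /eqP ->; rewrite expr0.
Qed.

Lemma cmonom_eval_mmorphism : mmorphism cmonom_eval.
Proof.
split=> [m n|]; last by rewrite /cmonom_eval mdom1 big_seq_fset0.
rewrite (@cmonom_evalEw (finsupp (m * n)%M)) //.
rewrite (@cmonom_evalEw (finsupp (m * n)%M) m) ?mdomD ?fsubsetUl //.
rewrite (@cmonom_evalEw (finsupp m `|` finsupp n)%fset n) ?fsubsetUr //.
by rewrite -big_split; apply: eq_bigr => i _; rewrite cmM exprD.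
Qed.

HB.instance Definition _ := isMultiplicative.Build _ S cmonom_eval
  cmonom_eval_mmorphism.

Lemma cmonom_evalU i : cmonom_eval (ucm i) = v i.
Proof. by rewrite /cmonom_eval mdomU big_seq_fset1 cmUU expr1. Qed.

End MonomialInduction.

Section Evaluation.
Variables (R : realType) (W : formAlg R) (b : idx -> W).

Fixpoint tree_eval (t : tree) : W :=
  match t with
  | Leaf i => b i
  | Node t u => amul (tree_eval t) (tree_eval u)
  end.

Lemma tree_eval_comm t u : tree_comm t u -> tree_eval t = tree_eval u.
Proof.
elim=> //= {t u} [t u v _ -> _ ->//|t u|t t' u u' _ -> _ ->//].
exact: amulC.
Qed.

Definition magma_eval (x : magma) : W := tree_eval (repr x).

Lemma magma_eval_pi t : magma_eval (\pi_magma t) = tree_eval t.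
Proof.
apply/tree_eval_comm/asboolP; rewrite -/(tree_commb _ _) -eqmodE.
by rewrite reprK.
Qed.

Lemma magma_eval_gen i : magma_eval (xgen i) = b i.
Proof. exact: magma_eval_pi. Qed.

Lemma magma_evalM x y :
  magma_eval (xmul x y) = amul (magma_eval x) (magma_eval y).
Proof. exact: magma_eval_pi. Qed.

Hypothesis frobW : forall u v w : W, aform u (amul v w) = aform (amul u v) w.

Definition pair_eval (p : magma * magma) : R :=
  aform (magma_eval p.1) (magma_eval p.2).

(** The generating step of [assoc_rel] is the Frobenius identity, so every indeterminate of [Rhat]
    has a well-defined real value. *)
Lemma pair_eval_assoc p q : assoc_rel p q -> pair_eval p = pair_eval q.
Proof.
elim=> {p q} [//|//|p q r _ -> _ ->//|x y z].
by rewrite /pair_eval /= !magma_evalM frobW.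
Qed.

Definition indet_eval (i : indet) : R := pair_eval (repr i).

Lemma indet_eval_pi p : indet_eval (\pi_indet p) = pair_eval p.
Proof.
apply/pair_eval_assoc/asboolP; rewrite -/(assoc_relb _ _) -eqmodE.
by rewrite reprK.
Qed.

Definition Rhat_eval : Rhat R -> R := mmap idfun (cmonom_eval indet_eval).

HB.instance Definition _ := GRing.RMorphism.copy Rhat_eval
  (mmap idfun (cmonom_eval indet_eval)).

Lemma Rhat_evalC c : Rhat_eval (malgC_Rhat R c) = c.
Proof. exact: mmapC. Qed.

Lemma Rhat_eval_lam x y :
  Rhat_eval (lam R x y) = aform (magma_eval x) (magma_eval y).
Proof. by rewrite /Rhat_eval mmapU mul1r cmonom_evalU indet_eval_pi. Qed.

Definition Mhat_eval (u : Mhat R) : W :=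
  \sum_(x <- msupp (u : {malg (Rhat R)[magma]}))
    Rhat_eval (mcoeff x u) *: magma_eval x.

Local Notation mhat_coeff u x := (mcoeff x (u : {malg (Rhat R)[magma]})).
Local Notation monom x := (<< x >> : {malg (Rhat R)[magma]}).

Lemma Mhat_evalEw (D : {fset magma}) (u : Mhat R) :
  (msupp (u : {malg (Rhat R)[magma]}) `<=` D)%fset ->
  Mhat_eval u = \sum_(x <- D) Rhat_eval (mhat_coeff u x) *: magma_eval x.
Proof.
move=> sD; rewrite /Mhat_eval; apply: big_fset_incl => // x _ /mcoeff_outdom ->.
by rewrite rmorph0 scale0r.
Qed.

Lemma Mhat_eval_linear : linear_for (Rhat_eval \; *:%R) Mhat_eval.
Proof.
move=> c u v; pose supp (w : Mhat R) := msupp (w : {malg (Rhat R)[magma]}).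
(* A common finite set containing the three supports lets the sums be compared termwise. *)
set D := (supp (c *: u + v)%R `|` (supp u `|` supp v))%fset.
rewrite !(@Mhat_evalEw D) /D ?fsubsetUl //; last 2 first.
- exact: fsubset_trans (fsubsetUr _ _) (fsubsetUr _ _).
- exact: fsubset_trans (fsubsetUl _ _) (fsubsetUr _ _).
rewrite /= scaler_sumr -big_split /=; apply: eq_bigr => x _.
by rewrite mcoeffD mcoeffZ rmorphD rmorphM scalerDl scalerA.
Qed.

HB.instance Definition _ := GRing.isLinear.Build (Rhat R) (Mhat R) W
  (Rhat_eval \; *:%R) Mhat_eval Mhat_eval_linear.

Lemma Mhat_eval_monom x : Mhat_eval (monom x) = magma_eval x.
Proof.
rewrite /Mhat_eval msuppU oner_eq0 big_seq_fset1 mcoeffUU.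
by rewrite rmorph1 scale1r.
Qed.

Lemma Mhat_evalE u : Mhat_eval u =
  \sum_(x <- msupp (u : {malg (Rhat R)[magma]}))
    Rhat_eval (mhat_coeff u x) *: magma_eval x.
Proof. by []. Qed.

Lemma Mhat_evalM u v : Mhat_eval (amul u v) = amul (Mhat_eval u) (Mhat_eval v).
Proof.
rewrite -[amul u v]/(mmulhat u v) /mmulhat /bilext linear_sum /=.
rewrite [Mhat_eval u in RHS]Mhat_evalE amulC linear_sum.
apply: eq_bigr => x _.
rewrite linear_sum linearZ /= amulC [Mhat_eval v in RHS]Mhat_evalE linear_sum.
rewrite scaler_sumr; apply: eq_bigr => y _.
by rewrite linearZ /= linearZ /= Mhat_eval_monom magma_evalM rmorphM scalerA.
Qed.

Lemma Rhat_eval_form u v :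
  Rhat_eval (aform u v) = aform (Mhat_eval u) (Mhat_eval v).
Proof.
rewrite -[aform u v]/(formhat u v) /formhat /bilext rmorph_sum /=.
rewrite -[RHS]/(aform_op _ _) [Mhat_eval u in RHS]Mhat_evalE linear_sum.
apply: eq_bigr => x _.
rewrite rmorph_sum linearZ /= /aform_op [Mhat_eval v in RHS]Mhat_evalE.
rewrite linear_sum mulr_sumr; apply: eq_bigr => y _.
by rewrite !rmorphM /= Rhat_eval_lam linearZ /= mulrA.
Qed.

Lemma pi_magma_Node t u :
  \pi_magma (Node t u) = xmul (\pi_magma t) (\pi_magma u).
Proof.
apply/eqP; rewrite eqmodE; apply/asboolP/tree_comm_node; apply/asboolP;
  by rewrite -/(tree_commb _ _) -eqmodE reprK.
Qed.

Lemma amul_monom x y :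
  amul (monom x : Mhat R) (monom y : Mhat R) = monom (xmul x y) :> Mhat R.
Proof.
rewrite -[LHS]/(mmulhat (monom x) (monom y)) /mmulhat /bilext.
by rewrite !msuppU oner_eq0 !big_seq_fset1 !mcoeffUU mulr1 scale1r.
Qed.

Lemma aform_monom x y :
  aform (monom x : Mhat R) (monom y : Mhat R) = lam R x y.
Proof.
rewrite -[LHS]/(formhat (monom x) (monom y)) /formhat /bilext.
by rewrite !msuppU oner_eq0 !big_seq_fset1 !mcoeffUU mulr1 scale1r.
Qed.

(** Constants and indeterminates generate the ring [Rhat]; after splitting into monomials,
    [cmonom_ind] peels off one indeterminate at a time. *)
Lemma Rhat_rmorphism_ext (S : comNzRingType)
    (phi psi : {rmorphism Rhat R -> S}) :
  (forall c, phi (malgC_Rhat R c) = psi (malgC_Rhat R c)) ->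
  (forall x y, phi (lam R x y) = psi (lam R x y)) -> phi =1 psi.
Proof.
move=> eqC eqlam c; rewrite [c]monalgE !rmorph_sum; apply: eq_bigr => m _.
have -> : << mcoeff m c *g m >> = malgC_Rhat R (mcoeff m c) * << m >> :> Rhat R.
  by rewrite [RHS]fgmulUU mulr1 mul1m.
rewrite !rmorphM; apply: congr2; first exact: eqC.
elim/cmonom_ind: m => [|i m IHm]; first by rewrite !rmorph1.
have -> : << (ucm i * m)%M >> = << ucm i >> * << m >> :> Rhat R.
  by rewrite [RHS]fgmulUU mulr1.
rewrite !rmorphM; apply: congr2 IHm.
by rewrite -[i]reprK; case: (repr i) => x y; apply: eqlam.
Qed.

Section Factorization.
Variables (q : ideal_pair (Mhat R)).
Variable f : form_morphism (iotaq q) W (quot_alg q).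
Hypothesis fb : forall t, f (b t) = gen q t.

(** Induction on a tree representing the monomial: [f] and the projection are both multiplicative
    and agree on generators. *)
Lemma piM_monom x : piM q (monom x : Mhat R) = f (magma_eval x).
Proof.
rewrite -[x]reprK; elim: (repr x) => [t|t IHt u IHu].
  by rewrite magma_eval_pi /= fb.
rewrite pi_magma_Node magma_evalM form_morphismM -IHt -IHu.
by rewrite -amul_monom -mulqE.
Qed.

(** Both sides are ring morphisms in [c]; on an indeterminate they agree because [f] and the
    projection are compatible with the forms. *)
Lemma piR_eval c : piR q c = iotaq q (Rhat_eval c).
Proof.
apply: (Rhat_rmorphism_ext (phi := @piR _ _ q) (psi := iotaq q \o Rhat_eval)).
  by move=> d; rewrite /= Rhat_evalC.
move=> x y; rewrite -[RHS]/(iotaq q (Rhat_eval _)) Rhat_eval_lam.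
rewrite -(form_morphism_form f) -!piM_monom.
by rewrite -aform_monom; apply: esym; apply: formqE.
Qed.

Lemma piM_eval u : piM q u = f (Mhat_eval u).
Proof.
rewrite [u in LHS]monalgE Mhat_evalE linear_sum linear_sum.
apply: eq_bigr => x _.
have -> : << mhat_coeff u x *g x >>
    = mhat_coeff u x *: (monom x : Mhat R) :> Mhat R.
  by apply/malgP => y; rewrite mcoeffZ !mcoeffU mulrnAr mulr1.
by rewrite linearZ linearZ /= piM_monom piR_eval.
Qed.

Lemma form_morphism_surj v : exists w, f w = v.
Proof. by exists (Mhat_eval (repr v)); rewrite -piM_eval piM_repr. Qed.

(** Injectivity is automatic for a ring morphism out of a field; surjectivity holds because [piR]
    factors through the reals. *)
Lemma iotaq_bij : bijective (iotaq q).
Proof.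
apply: inj_surj_bij; first exact: fmorph_inj.
by move=> c; exists (Rhat_eval (repr c)); rewrite -piR_eval piR_repr.
Qed.

End Factorization.

Definition ker_Rhat : {pred Rhat R} := [pred c | Rhat_eval c == 0].

Fact ker_Rhat_ideal : idealr_closed ker_Rhat.
Proof.
(* The ideal is proper, since 1 evaluates to 1. *)
split=> [||c u v]; rewrite !inE ?rmorph0 ?rmorph1 ?oner_eq0 //.
by move=> /eqP u0 /eqP v0; rewrite rmorphD rmorphM /= u0 v0 mulr0 addr0.
Qed.

HB.instance Definition _ := isIdealr.Build (Rhat R) ker_Rhat ker_Rhat_ideal.

Definition ker_Mhat : {pred Mhat R} := [pred u | Mhat_eval u == 0].

Fact ker_Mhat_zmod : zmod_closed ker_Mhat.
Proof.
split=> [|u v]; rewrite !inE ?linear0 // => /eqP u0 /eqP v0.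
by rewrite linearB /= u0 v0 subr0.
Qed.

HB.instance Definition _ := GRing.isZmodClosed.Build (Mhat R) ker_Mhat
  ker_Mhat_zmod.

Local Obligation Tactic := idtac.

Program Definition ker_pair : ideal_pair (Mhat R) :=
  @IdealPair _ (Mhat R) ker_Rhat ker_Mhat _ _ _ _ _.
Next Obligation.
by move=> c v; rewrite !inE => /eqP v0; rewrite linearZ /= v0 scaler0.
Qed.
Next Obligation.
by move=> u v; rewrite !inE => /eqP v0; rewrite Mhat_evalM v0 linear0.
Qed.
Next Obligation.
by move=> c v; rewrite !inE => /eqP c0; rewrite linearZ /= c0 scale0r.
Qed.
Next Obligation.
move=> u v; rewrite !inE => /eqP u0.
by rewrite Rhat_eval_form -[aform _ _]/(aform_op _ _) u0 linear0.
Qed.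
Next Obligation.
by move=> u v; rewrite !inE => /eqP v0; rewrite Rhat_eval_form v0 linear0.
Qed.

Hypothesis genW : gen_subalgebra (range b) = setT.

(** The image of the evaluation is a real subalgebra, the constants of [Rhat] providing the scalars,
    and it contains the generators. *)
Lemma Mhat_eval_surj w : exists u, Mhat_eval u = w.
Proof.
have: gen_subalgebra (range b) w by rewrite genW.
move=> /(_ [set w | exists u, Mhat_eval u = w]) H.
apply: H => [|_ [t _ <-]]; last first.
  by exists (monom (xgen t)); rewrite Mhat_eval_monom magma_eval_gen.
split=> [|c _ _ [u <-] [v <-]|_ _ [u <-] [v <-]].
- by exists 0; rewrite linear0.
- by exists (malgC_Rhat R c *: u + v); rewrite linearP /= Rhat_evalC.
- by exists (amul u v); rewrite Mhat_evalM.
Qed.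

Let lift w := sval (cid (Mhat_eval_surj w)).

Let liftK w : Mhat_eval (lift w) = w.
Proof. by rewrite /lift; case: cid. Qed.

Let piM_ker u v : Mhat_eval u = Mhat_eval v -> piM ker_pair u = piM ker_pair v.
Proof. by move=> uv; apply/piM_eq; rewrite inE linearB /= uv subrr. Qed.

Let piR_ker c d : Rhat_eval c = Rhat_eval d -> piR ker_pair c = piR ker_pair d.
Proof. by move=> cd; apply/piR_eq; rewrite inE rmorphB /= cd subrr. Qed.

(** Inverts the evaluation modulo its kernel. Two lifts of the same vector have the same class, so
    the arbitrary choice made by [lift] respects all operations. *)
Program Definition ker_morphism :
    form_morphism (iotaq ker_pair) W (quot_alg ker_pair) :=
  @FormMorphism _ _ _ W _ (fun w => piM ker_pair (lift w)) _ _ _.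
Next Obligation.
move=> c u v; rewrite -[LHS](piM_ker (u := malgC_Rhat R c *: lift u + lift v)).
  by rewrite piMD piMZ.
by rewrite linearP /= Rhat_evalC !liftK.
Qed.
Next Obligation.
move=> u v; apply: etrans _ (esym (mulqE _ _ _)); apply: piM_ker.
by rewrite Mhat_evalM !liftK.
Qed.
Next Obligation.
move=> u v; apply: etrans (formqE _ _ _) _; apply: piR_ker.
by rewrite Rhat_eval_form !liftK Rhat_evalC.
Qed.

Lemma ker_morphism_gen t : ker_morphism (b t) = gen ker_pair t.
Proof.
by apply: piM_ker; rewrite liftK Mhat_eval_monom magma_eval_gen.
Qed.

(** For injectivity, a lift of a vector killed by [f] lies in [idI q], hence in the kernel of the
    evaluation, so the vector is 0. *)
Lemma form_morphism_bij (q : ideal_pair (Mhat R))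
    (f : form_morphism (iotaq q) W (quot_alg q)) :
  (forall t, f (b t) = gen q t) -> {subset idI q <= idI ker_pair} ->
  bijective f.
Proof.
move=> fb sub; apply: inj_surj_bij; last exact: form_morphism_surj.
apply: raddf_inj => w /=; rewrite -(liftK w) -(piM_eval fb).
move=> w0; have /piM_eq : piM q (lift w) = piM q 0 by rewrite w0 linear0.
by rewrite subr0 => /sub; rewrite inE => /eqP ->.
Qed.

Lemma ker_pair_min (q : ideal_pair (Mhat R))
    (f : form_morphism (iotaq q) W (quot_alg q)) :
  (forall t, f (b t) = gen q t) ->
  {subset idI ker_pair <= idI q} /\ {subset idJ ker_pair <= idJ q}.
Proof.
move=> fb; split=> [u|c]; rewrite inE => /eqP ev0.
  rewrite -[u]subr0; apply/piM_eq; rewrite !(piM_eval fb) ev0.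
  by rewrite [Mhat_eval 0]linear0.
rewrite -[c]subr0; apply/piR_eq; rewrite !(piR_eval fb) ev0.
by rewrite [Rhat_eval 0]rmorph0.
Qed.

End Evaluation.

(** * The 7-dimensional algebra *)

(** The index [None] stands for a_rho. *)
Definition bidx : finType := option idx.

Definition o0 : 'I_3 := Ordinal (isT : 0 < 3)%N.
Definition o1 : 'I_3 := Ordinal (isT : 1 < 3)%N.
Definition o2 : 'I_3 := Ordinal (isT : 2 < 3)%N.

Lemma I3_cases (i : 'I_3) : [\/ i = o0, i = o1 | i = o2].
Proof.
by case: i => [[|[|[|//]]] ?];
  [apply: Or31 | apply: Or32 | apply: Or33]; apply: val_inj.
Qed.

(** Makes sums over the basis explicit, so that [field] can decide coordinate identities. *)
Lemma sum_bidx (V : nmodType) (F : bidx -> V) :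
  \sum_k F k = F None
    + (F (Some (true, o0)) + F (Some (true, o1)) + F (Some (true, o2)))
    + (F (Some (false, o0)) + F (Some (false, o1)) + F (Some (false, o2))).
Proof.
rewrite (bigD1 None) //= (reindex_omap some id) => [|[]//].
rewrite (eq_bigl xpredT) => [|t]; last by rewrite eqxx.
under eq_bigr do rewrite [X in Some X]surjective_pairing.
rewrite -(pair_bigA _ (fun e i => F (Some (e, i)))) big_bool /=.
rewrite !big_ord_recl !big_ord0 !addr0 !addrA.
by do ![congr (_ + _)]; congr (F (Some (_, _))); apply: val_inj.
Qed.

Section Table.
Variables (R : realType) (S : comNzRingType) (iota : {rmorphism R -> S}).

(** Generic in the family and in [iota]: the same table defines the product of [alg4B], gives the
    coordinates of that product, and states that a family in another algebra multiplies in this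
    way. *)
Definition table4B (V : lmodType S) (b : bidx -> V) (i j : bidx) : V :=
  match i, j with
  | None, None => b None
  | Some t, None | None, Some t =>
      iota 8^-1 *: (b (Some t) + b None - b (Some (opp_idx t)))
  | Some s, Some t =>
      if s == t then b (Some s)
      else if s.2 == t.2 then iota 8^-1 *: (b (Some s) + b (Some t) - b None)
      else iota 64^-1 *: (b (Some s) + b (Some t) - b (Some (opp_idx s))
                          - b (Some (opp_idx t)) + b None)
  end.

Definition gram4B (i j : bidx) : R :=
  if i == j then 1
  else match i, j with
       | Some s, Some t => if s.2 == t.2 then 8^-1 else 64^-1
       | _, _ => 8^-1
       end.

End Table.

Section Algebra4B.
Variable R : realType.

Definition vec4B : lmodType R := {ffun bidx -> R^o}.

Definition e4B (k : bidx) : vec4B := [ffun j => (k == j)%:R].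

Definition mul4B (x y : vec4B) : vec4B :=
  \sum_i \sum_j (x i * y j) *: table4B idfun e4B i j.

Definition form4B (x y : vec4B) : R := \sum_i \sum_j x i * y j * gram4B R i j.

Lemma table4BC i j : table4B idfun e4B i j = table4B idfun e4B j i.
Proof.
case: i j => [s|] [t|] //=; rewrite [t == s]eq_sym [t.2 == s.2]eq_sym.
case: eqVneq => [->//|_]; case: eqP => _; rewrite [e4B (Some s) + _]addrC //.
by rewrite -!addrA; congr (_ *: (_ + (_ + _))); rewrite addrCA.
Qed.

Lemma mul4BC : commutative mul4B.
Proof.
move=> x y; rewrite /mul4B exchange_big; apply: eq_bigr => i _.
by apply: eq_bigr => j _; rewrite table4BC mulrC.
Qed.

Lemma mul4B_linear c u v w : mul4B (c *: u + v) w = c *: mul4B u w + mul4B v w.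
Proof.
rewrite /mul4B scaler_sumr -big_split; apply: eq_bigr => i _ /=.
rewrite scaler_sumr -big_split; apply: eq_bigr => j _ /=.
by rewrite scalerA -scalerDl !ffunE mulrDl mulrA.
Qed.

Lemma form4B_linearl c u v w :
  form4B (c *: u + v) w = c * form4B u w + form4B v w.
Proof.
rewrite /form4B mulr_sumr -big_split; apply: eq_bigr => i _ /=.
rewrite mulr_sumr -big_split; apply: eq_bigr => j _ /=.
by rewrite !ffunE !mulrDl !mulrA.
Qed.

Lemma form4B_linearr c u v w :
  form4B u (c *: v + w) = c * form4B u v + form4B u w.
Proof.
rewrite /form4B mulr_sumr -big_split; apply: eq_bigr => i _ /=.
rewrite mulr_sumr -big_split; apply: eq_bigr => j _ /=.
by rewrite !ffunE mulrDr mulrDl !mulrA [u i * c]mulrC.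
Qed.

Definition alg4B : formAlg R :=
  FormAlg mul4BC mul4B_linear form4B_linearl form4B_linearr.

End Algebra4B.

Section Coordinates.
Variable R : realType.

Lemma table4B_coord i j k : table4B idfun (e4B R) i j k =
  table4B idfun (fun l => (l == k)%:R : R^o) i j.
Proof.
have eE l : e4B R l k = (l == k)%:R by rewrite ffunE.
by case: i j => [s|] [t|] //=; try (do ?case: ifP => _);
  rewrite -?eE //; rewrite !ffunE.
Qed.

Implicit Types x y z : alg4B R.

Definition axes_sum x : R :=
  x (Some (true, o0)) + x (Some (true, o1)) + x (Some (true, o2))
  + (x (Some (false, o0)) + x (Some (false, o1)) + x (Some (false, o2))).

Definition axes_dot x y : R :=
  x (Some (true, o0)) * y (Some (true, o0))
  + x (Some (true, o1)) * y (Some (true, o1))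
  + x (Some (true, o2)) * y (Some (true, o2))
  + x (Some (false, o0)) * y (Some (false, o0))
  + x (Some (false, o1)) * y (Some (false, o1))
  + x (Some (false, o2)) * y (Some (false, o2)).

Definition axes_dot_opp x y : R :=
  x (Some (true, o0)) * y (Some (false, o0))
  + x (Some (true, o1)) * y (Some (false, o1))
  + x (Some (true, o2)) * y (Some (false, o2))
  + x (Some (false, o0)) * y (Some (true, o0))
  + x (Some (false, o1)) * y (Some (true, o1))
  + x (Some (false, o2)) * y (Some (true, o2)).

(** Closed form of the product. In the coordinate of a_rho, all pairs of axes are first counted with
    1/64; equal pairs are then removed, and the factor 9 = 1 + 8 turns 1/64 into -1/8 for opposite
    pairs. *)
Definition mul4B_coord x y (k : bidx) : R :=
  match k with
  | None =>
      x None * y None + (axes_sum x * y None + x None * axes_sum y) / 8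
      + (axes_sum x * axes_sum y - axes_dot x y - 9 * axes_dot_opp x y) / 64
  | Some t =>
      let xt := x (Some t) in let xt' := x (Some (opp_idx t)) in
      let yt := y (Some t) in let yt' := y (Some (opp_idx t)) in
      xt * yt + (xt * yt' + xt' * yt + (xt - xt') * y None
                 + x None * (yt - yt')) / 8
      + ((xt - xt') * (axes_sum y - yt - yt')
         + (yt - yt') * (axes_sum x - xt - xt')) / 64
  end.

Lemma mul4BE x y k : amul x y k = mul4B_coord x y k.
Proof.
rewrite -[amul x y]/(mul4B x y) /mul4B sum_ffunE.
under eq_bigr do rewrite sum_ffunE.
under eq_bigr do under eq_bigr do rewrite ffunE table4B_coord.
under eq_bigr do rewrite sum_bidx.
rewrite sum_bidx /mul4B_coord /axes_sum /axes_dot /axes_dot_opp.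
case: k => [[e i]|]; last first.
  by rewrite /table4B /opp_idx /= /GRing.scale /=; field.
by case: e; case: (I3_cases i) => ->;
  rewrite /table4B /opp_idx /= /GRing.scale /=; field.
Qed.

(** All pairs of axes are counted with 1/64; adding 63/64 gives 1 for equal axes, and adding 7/64
    gives 1/8 for opposite ones. *)
Lemma form4BE x y : aform x y =
  x None * y None + (axes_sum x * y None + x None * axes_sum y) / 8
  + (axes_sum x * axes_sum y + 63 * axes_dot x y + 7 * axes_dot_opp x y) / 64.
Proof.
rewrite -[aform x y]/(form4B x y) /form4B; under eq_bigr do rewrite sum_bidx.
rewrite sum_bidx /axes_sum /axes_dot /axes_dot_opp.
by rewrite /gram4B /=; field.
Qed.

Lemma form4B_frobenius x y z : aform x (amul y z) = aform (amul x y) z.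
Proof.
rewrite !form4BE /axes_sum /axes_dot /axes_dot_opp !mul4BE /mul4B_coord.
by rewrite /axes_sum /axes_dot /axes_dot_opp /opp_idx /=; field.
Qed.

End Coordinates.

(** * The eigenspaces of one axis *)

Lemma amulZl (S : comNzRingType) (V : formAlg S) c (u v : V) :
  amul (c *: u) v = c *: amul u v.
Proof. by rewrite !(amulC _ v) linearZ. Qed.

Section Projections.
Variable R : realType.
Implicit Types (x y z : alg4B R) (p q u v : R).

Lemma bidx_ind (P : bidx -> Prop) :
  P None -> P (Some (true, o0)) -> P (Some (true, o1)) -> P (Some (true, o2)) ->
  P (Some (false, o0)) -> P (Some (false, o1)) -> P (Some (false, o2)) ->
  forall k, P k.
Proof.
by move=> ? ? ? ? ? ? ? [[[] i]|] //; case: (I3_cases i) => ->.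
Qed.

Lemma add4BE x y k : (x + y) k = x k + y k.
Proof. by rewrite ffunE. Qed.

Lemma scale4BE p x k : (p *: x) k = p * x k.
Proof. by rewrite ffunE. Qed.

Definition coords4B r a a' b b' c c' (k : bidx) : R :=
  match k with
  | None => r
  | Some (e, i) =>
      match val i with
      | 0%N => if e then a else a'
      | 1%N => if e then b else b'
      | _ => if e then c else c'
      end
  end.

Definition of_coords r a a' b b' c c' : alg4B R :=
  [ffun k => coords4B r a a' b b' c c' k].

Lemma of_coordsE r a a' b b' c c' k :
  of_coords r a a' b b' c c' k = coords4B r a a' b b' c c' k.
Proof. by rewrite ffunE. Qed.

Lemma of_coords0 : of_coords 0 0 0 0 0 0 0 = 0.
Proof. by apply/ffunP; elim/bidx_ind; rewrite of_coordsE ffunE. Qed.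

(** Parametrisations of the eigenspaces of [axis0]; the coefficients below read
    off the component of a vector in each of them. *)
Definition eig1 q := of_coords 0 q 0 0 0 0 0.
Definition eig0 p u v :=
  of_coords p (- p / 4 - (u + v) / 16) (p + (u + v) / 4) u u v v.
Definition eig4 q := of_coords (- q) 0 q 0 0 0 0.
Definition eig32 u v := of_coords 0 0 0 u (- u) v (- v).

(** This is the form of [axis0] with [x]: the eigenspaces are orthogonal for a Frobenius form, and
    [axis0] has norm 1. *)
Definition axis_coef1 x : R :=
  x (Some (true, o0)) + (x (Some (false, o0)) + x None) / 8
  + (x (Some (true, o1)) + x (Some (false, o1))
     + x (Some (true, o2)) + x (Some (false, o2))) / 64.

Definition axis_coef4 x : R :=
  (x (Some (false, o0)) - x None) / 2
  - (x (Some (true, o1)) + x (Some (false, o1))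
     + x (Some (true, o2)) + x (Some (false, o2))) / 16.

Definition half_sum x i : R := (x (Some (true, i)) + x (Some (false, i))) / 2.
Definition half_diff x i : R := (x (Some (true, i)) - x (Some (false, i))) / 2.

(** In the 0-component, [axis_coef4] is added to the coordinate at a_rho because [eig4 q]
    contributes -q there. *)
Definition proj (l : monster) x : alg4B R :=
  match l with
  | M1 => eig1 (axis_coef1 x)
  | M0 => eig0 (x None + axis_coef4 x) (half_sum x o1) (half_sum x o2)
  | M4 => eig4 (axis_coef4 x)
  | M32 => eig32 (half_diff x o1) (half_diff x o2)
  end.

Definition axis0 : alg4B R := e4B R (Some (true, o0)).

Lemma eig1E q : eig1 q = q *: axis0.
Proof.
by apply/ffunP; elim/bidx_ind;
  rewrite scale4BE of_coordsE ffunE /= ?mulr1 ?mulr0.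
Qed.

Ltac expand4B :=
  rewrite ?mul4BE /mul4B_coord /axes_sum /axes_dot /axes_dot_opp;
  rewrite /eig1 /eig0 /eig4 /eig32;
  rewrite ?of_coordsE /opp_idx /=.

Lemma proj_linear l : linear (proj l).
Proof.
move=> c x y; apply/ffunP; elim/bidx_ind; rewrite add4BE scale4BE; case: l;
  rewrite !of_coordsE /= /axis_coef1 /axis_coef4 /half_sum /half_diff
    ?(add4BE, scale4BE); by field.
Qed.

HB.instance Definition _ l :=
  GRing.isLinear.Build R (alg4B R) (alg4B R) *:%R (proj l) (proj_linear l).

Lemma projZ l c x : proj l (c *: x) = c *: proj l x.
Proof. exact: linearZ. Qed.

Lemma sum_proj x : \sum_(l <- monsters) proj l x = x.
Proof.
rewrite !big_cons big_nil addr0; apply/ffunP; elim/bidx_ind;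
  rewrite !add4BE !of_coordsE /= /axis_coef1 /axis_coef4 /half_sum /half_diff;
  by field.
Qed.

Lemma mul_axis0_proj l x : amul axis0 (proj l x) = monster_val R l *: proj l x.
Proof.
have -> : axis0 = eig1 1 by rewrite eig1E scale1r.
case: l; rewrite /proj;
  move: (axis_coef1 x) (axis_coef4 x) (half_sum x) (half_diff x) => p q u v;
apply/ffunP; elim/bidx_ind; rewrite scale4BE; expand4B; by field.
Qed.

Lemma proj_proj l m x : proj l (proj m x) = if l == m then proj m x else 0.
Proof.
rewrite -[0]of_coords0.
case: m; rewrite /proj;
  move: (axis_coef1 x) (axis_coef4 x) (half_sum x) (half_diff x) => p q u v;
  case: l; rewrite /=; congr of_coords;
  rewrite /axis_coef1 /axis_coef4 /half_sum /half_diff; expand4B; by field.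
Qed.

Lemma fusionC l m : fusion l m = fusion m l.
Proof. by case: l m => -[]. Qed.

(** The fusion rule, phrased as the vanishing of the forbidden components, becomes a finite list of
    polynomial identities. *)
Lemma proj_fusion l m n x y :
  n \notin fusion l m -> proj n (amul (proj l x) (proj m y)) = 0.
Proof.
(* Commutativity halves the number of cases. *)
wlog le_lm : l m x y / (index l monsters <= index m monsters)%N => [H|].
  case/orP: (leq_total (index l monsters) (index m monsters)) => [|le_ml].
    exact: H.
  rewrite amulC fusionC; exact: H.
(* The 1-component is a multiple of [axis0], so the product is a multiple of [proj m y]. Its
   component at n = m is forbidden only for [M0], where the eigenvalue is 0. *)
have [->|l1] := eqVneq l M1 => [n_lm|].
  rewrite -[proj M1 x]/(eig1 _) eig1E amulZl mul_axis0_proj !projZ proj_proj.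
  case: eqP => [nm|_]; last by rewrite !scaler0.
  move: n_lm; rewrite nm; case: m {le_lm nm} => // _.
  by rewrite scale0r scaler0.
rewrite -[0]of_coords0 /proj.
(* The coefficients become free parameters, which keeps the identities given to [field] small. *)
move: (axis_coef1 x) (axis_coef4 x) (half_sum x) (half_diff x)
  (x None + axis_coef4 x) => p q u v w.
move: (axis_coef1 y) (axis_coef4 y) (half_sum y) (half_diff y)
  (y None + axis_coef4 y) => p' q' u' v' w'.
case: l l1 le_lm => // _; case: m => // _; case: n => // _; congr of_coords;
  rewrite /axis_coef1 /axis_coef4 /half_sum /half_diff; expand4B; by field.
Qed.

End Projections.

Arguments proj {R} l x : simpl never.

(** * Morphisms out of the 7-dimensional algebra *)

Section TableMorphism.
Variables (R : realType) (S : comNzRingType) (iota : {rmorphism R -> S}).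
Variable V : formAlg S.

Definition has_table4B (b : bidx -> V) : Prop :=
  forall i j, amul (b i) (b j) = table4B iota b i j
           /\ aform (b i) (b j) = iota (gram4B R i j).

Lemma e4B_sum (x : vec4B R) : x = \sum_k x k *: e4B R k.
Proof.
apply/ffunP => j; rewrite sum_ffunE (bigD1 j) //= big1 => [|k kj].
  by rewrite !ffunE eqxx addr0 [_ *: _]mulr1.
by rewrite !ffunE (negPf kj) [_ *: _]mulr0.
Qed.

Lemma mul_e4B i j :
  amul (e4B R i : alg4B R) (e4B R j) = table4B idfun (e4B R) i j.
Proof.
rewrite -[LHS]/(mul4B (e4B R i) (e4B R j)) /mul4B.
rewrite (bigD1 i) //= [X in _ + X]big1 => [|k ki]; last first.
  by rewrite big1 // => l _; rewrite !ffunE eq_sym (negPf ki) mul0r scale0r.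
rewrite (bigD1 j) //= big1 => [|k kj]; last first.
  by rewrite !ffunE [j == k]eq_sym (negPf kj) mulr0 scale0r.
by rewrite !ffunE !eqxx mulr1 scale1r !addr0.
Qed.

Lemma form_e4B i j : aform (e4B R i : alg4B R) (e4B R j) = gram4B R i j.
Proof.
rewrite -[LHS]/(form4B (e4B R i) (e4B R j)) /form4B.
rewrite (bigD1 i) //= [X in _ + X]big1 => [|k ki]; last first.
  by rewrite big1 // => l _; rewrite !ffunE eq_sym (negPf ki) !mul0r.
rewrite (bigD1 j) //= big1 => [|k kj]; last first.
  by rewrite !ffunE [j == k]eq_sym (negPf kj) mulr0 mul0r.
by rewrite !ffunE !eqxx !mul1r !addr0.
Qed.

Lemma linear_table4B (f : {linear alg4B R -> V | iota \; *:%R}) i j :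
  f (table4B idfun (e4B R) i j) = table4B iota (f \o e4B R) i j.
Proof.
have fZ c u : f (c *: u) = iota c *: f u by rewrite linearZ.
by case: i j => [s|] [t|] //=; do ?case: ifP => // _;
  rewrite fZ !(raddfD, raddfN).
Qed.

(** Together with its converse [table_morphism], this identifies morphisms out of [alg4B] with
    families having the table. *)
Lemma form_morphism_has_table (f : form_morphism iota (alg4B R) V) :
  has_table4B (f \o e4B R).
Proof.
move=> i j; rewrite -linear_table4B -mul_e4B -form_e4B.
by split; [exact/esym/form_morphismM | exact: form_morphism_form].
Qed.

Variable b : bidx -> V.
Hypothesis tab : has_table4B b.

Definition lincomb4B (x : alg4B R) : V := \sum_k iota (x k) *: b k.

Lemma lincomb4B_linear : linear_for (iota \; *:%R) lincomb4B.
Proof.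
move=> c x y; rewrite /lincomb4B /= scaler_sumr -big_split.
apply: eq_bigr => k _.
by rewrite add4BE scale4BE rmorphD rmorphM scalerDl scalerA.
Qed.

HB.instance Definition _ := GRing.isLinear.Build R (alg4B R) V (iota \; *:%R)
  lincomb4B lincomb4B_linear.

Lemma lincomb4B_e k : lincomb4B (e4B R k) = b k.
Proof.
rewrite /lincomb4B (bigD1 k) //= big1 => [|j jk].
  by rewrite ffunE eqxx rmorph1 scale1r addr0.
by rewrite ffunE eq_sym (negPf jk) rmorph0 scale0r.
Qed.

Lemma lincomb4BM x y :
  lincomb4B (amul x y) = amul (lincomb4B x) (lincomb4B y).
Proof.
rewrite -[amul x y]/(mul4B x y) /mul4B linear_sum [in RHS]/lincomb4B.
rewrite amulC linear_sum; apply: eq_bigr => i _.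
rewrite linear_sum linearZ /= amulC linear_sum scaler_sumr.
apply: eq_bigr => j _.
rewrite linearZ /= linearZ /= rmorphM scalerA; congr (_ *: _).
have [-> _] := tab i j.
rewrite linear_table4B; congr (table4B _ _ _ _); apply/funext => k.
exact: lincomb4B_e.
Qed.

Lemma lincomb4B_form x y :
  aform (lincomb4B x) (lincomb4B y) = iota (aform x y).
Proof.
rewrite -[aform x y]/(form4B x y) /form4B /lincomb4B rmorph_sum.
rewrite -[LHS]/(aform_op _ _) linear_sum; apply: eq_bigr => i _.
rewrite linearZ /= /aform_op linear_sum rmorph_sum mulr_sumr.
apply: eq_bigr => j _.
by rewrite linearZ /= !rmorphM mulrA; case: (tab i j) => _ ->.
Qed.

Definition table_morphism : form_morphism iota (alg4B R) V :=
  FormMorphism lincomb4B_linear lincomb4BM lincomb4B_form.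

Lemma table_morphism_e k : table_morphism (e4B R k) = b k.
Proof. exact: lincomb4B_e. Qed.

End TableMorphism.

(** * The axis property and the Miyamoto involution *)

Lemma monster_val_inj (R : realType) : injective (monster_val R).
Proof. by move=> [] [] //= ?; exfalso; lra. Qed.

(** Lets a sum over a fusion set be compared with the sum over all four labels. *)
Lemma fusion_filter l m : fusion l m = [seq n <- monsters | n \in fusion l m].
Proof. by case: l m => -[]. Qed.

Section Axis.
Variables (R : realType) (S : comNzRingType) (iota : {rmorphism R -> S}).
Variables (V : formAlg S) (f : form_morphism iota (alg4B R) V).
Hypothesis f_bij : bijective f.

Let f_inj : injective f := bij_inj f_bij.

Let f_surj v : exists x, f x = v.
Proof. by case: f_bij => g _ gK; exists (g v); rewrite gK. Qed.

Let fZ c x : f (c *: x) = iota c *: f x.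
Proof. by rewrite linearZ. Qed.

Lemma eigsp_morphism a l x :
  eigsp iota (f a) l (f x) <-> amul a x = monster_val R l *: x.
Proof.
by rewrite /eigsp /= -form_morphismM -fZ; split=> [/f_inj|->].
Qed.

Lemma proj_eigsp l x :
  eigsp iota (f (axis0 R)) l (f x) ->
  forall n, proj n x = if n == l then x else 0.
Proof.
(* Applying [proj n] to the eigenvector equation multiplies [proj n x] by the difference of two
   distinct eigenvalues and gives 0. *)
move=> /eigsp_morphism ax_x; have vanish n : n != l -> proj n x = 0.
  move=> nl; have: proj n (amul (axis0 R) x) = monster_val R n *: proj n x.
    rewrite -[x in amul _ x]sum_proj (linear_sum (amul _)).
    rewrite (raddf_sum (proj n)) /=.
    under eq_bigr do rewrite mul_axis0_proj projZ proj_proj.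
    by case: n {nl}; rewrite !big_cons big_nil /= ?scaler0 ?addr0 ?add0r.
  rewrite ax_x projZ => /eqP; rewrite -subr_eq0 -scalerBl scaler_eq0.
  rewrite subr_eq0 => /orP[/eqP/monster_val_inj ln|/eqP//].
  by rewrite ln eqxx in nl.
move=> n; case: eqVneq => [->|/vanish//].
rewrite -[RHS]sum_proj (bigD1_seq l) /=; last by [].
  by rewrite big1 ?addr0.
by case: (l).
Qed.

Lemma eigsp_proj l x : eigsp iota (f (axis0 R)) l (f (proj l x)).
Proof. by apply/eigsp_morphism; rewrite mul_axis0_proj. Qed.

Lemma mul_axis0 : amul (axis0 R) (axis0 R) = axis0 R.
Proof. by rewrite /axis0 mul_e4B /table4B eqxx. Qed.

Lemma axis0_is_axis : is_axis iota (f (axis0 R)).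
Proof.
split.
- by rewrite -form_morphismM mul_axis0.
- apply/seteqP; split=> // v _; have [x <-] := f_surj v.
  exists (fun l => f (proj l x)); split=> [l _|]; first exact: eigsp_proj.
  by rewrite -raddf_sum sum_proj.
(* Independence: applying [proj l] to the vanishing sum isolates its l-th term. *)
- move=> u eig_u; have [x def_u] := choice (fun l => f_surj (u l)).
  have eig_x l n : proj n (x l) = if n == l then x l else 0.
    by apply: proj_eigsp; rewrite def_u.
  under eq_bigr do rewrite -def_u.
  rewrite -raddf_sum -(raddf0 f) => /f_inj sum0 l.
  have := congr1 (proj l) sum0.
  rewrite (raddf_sum (proj l)) (raddf0 (proj l)) /=.
  under eq_bigr do rewrite eig_x.
  move=> xl0; rewrite -def_u; suff -> : x l = 0 by rewrite raddf0.
  by rewrite -{}xl0; case: l; rewrite !big_cons big_nil /= ?addr0 ?add0r.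
move=> l m v w; have [x <-] := f_surj v; have [y <-] := f_surj w.
move=> /proj_eigsp/(_ l); rewrite eqxx => px.
move=> /proj_eigsp/(_ m); rewrite eqxx => py.
(* The witness is the family of components of the product; those outside the fusion set vanish by
   [proj_fusion]. *)
exists (fun n => f (proj n (amul x y))).
split=> [n _|]; first exact: eigsp_proj.
rewrite -raddf_sum fusion_filter big_filter big_mkcond -form_morphismM.
rewrite -[in LHS](sum_proj (amul x y)); congr (f _).
apply: eq_bigr => n _; case: ifPn => // /(@proj_fusion R l m n x y).
by rewrite px py.
Qed.

Lemma axis0_is_primitive : is_primitive iota (f (axis0 R)).
Proof.
apply/seteqP; split=> [v|_ [c ->]].
  have [x <-] := f_surj v; move=> /proj_eigsp/(_ M1); rewrite eqxx => <-.
  by exists (iota (axis_coef1 x)); rewrite -fZ -eig1E.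
by rewrite /eigsp /= rmorph1 scale1r linearZ /= -form_morphismM mul_axis0.
Qed.

Lemma eigsum_proj (L : seq monster) x n :
  eigsum iota (f (axis0 R)) L (f x) -> n \notin L -> proj n x = 0.
Proof.
move=> [u [eig_u def_x]] nL; have [z def_u] := choice (fun l => f_surj (u l)).
have -> : x = \sum_(l <- L) z l.
  apply: f_inj; rewrite def_x raddf_sum.
  by apply: eq_bigr => l _; rewrite /= def_u.
rewrite raddf_sum big_seq big1 //= => l lL.
have /proj_eigsp -> : eigsp iota (f (axis0 R)) l (f (z l)).
  by rewrite def_u; exact: eig_u.
by case: eqVneq => // nl; rewrite nl lL in nL.
Qed.

Lemma miyamoto_axis0 x :
  miyamoto iota (f (axis0 R)) (f x) = f (x - proj M32 x - proj M32 x).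
Proof.
apply: xget_unique.
  exists (f (x - proj M32 x)), (f (proj M32 x)); split.
  - exists (fun l => f (proj l x)); split=> [l _|]; first exact: eigsp_proj.
    rewrite -raddf_sum; congr (f _); rewrite -[X in X - _](sum_proj x).
    by rewrite !big_cons !big_nil !addr0 !addrA addrK.
  - exists (fun l => f (proj l x)); split=> [l _|]; first exact: eigsp_proj.
    by rewrite big_seq1.
  - by rewrite -raddfD subrK.
  - by rewrite -raddfB.
(* Uniqueness: [vp] has no component for 1/32 and [vm] has no other, so [vm] is the image of
   [proj M32 x]. *)
move=> w [vp [vm [+ + def_x ->]]].
have [y def_y] := f_surj vp; have [z def_z] := f_surj vm.
rewrite -def_y -def_z in def_x *.
move=> /eigsum_proj y32 /eigsum_proj z32.
have {}def_x : x = y + z by apply: f_inj; rewrite def_x raddfD.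
have defz : z = proj M32 z.
  rewrite -[LHS]sum_proj !big_cons big_nil.
  by rewrite (z32 M1) // (z32 M0) // (z32 M4) // !add0r addr0.
rewrite -raddfB; congr (f _).
by rewrite def_x (raddfD (proj M32)) /= y32 // add0r -defz addrK.
Qed.

End Axis.

(** * Subspaces, spans and subalgebras *)

Section Subspace.
Variables (S : comNzRingType) (V : formAlg S).

Definition is_subspace (B : set V) : Prop :=
  B 0 /\ forall (c : S) u v, B u -> B v -> B (c *: u + v).

Lemma subalgebra_subspace B : is_subalgebra B -> is_subspace B.
Proof. by case. Qed.

Variable B : set V.
Hypothesis subB : is_subspace B.

Lemma subspace0 : B 0.
Proof. by case: subB. Qed.

Lemma subspaceP c u v : B u -> B v -> B (c *: u + v).
Proof. by case: subB => _; apply. Qed.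

Lemma subspaceZ c u : B u -> B (c *: u).
Proof. by move=> Bu; rewrite -[_ *: _]addr0; apply: subspaceP subspace0. Qed.

Lemma subspaceD u v : B u -> B v -> B (u + v).
Proof. by move=> Bu; rewrite -[u]scale1r; apply: subspaceP. Qed.

Lemma subspaceB u v : B u -> B v -> B (u - v).
Proof. by move=> Bu Bv; rewrite -scaleN1r; apply/subspaceD/subspaceZ. Qed.

Lemma subspace_lincomb (I : finType) (c : I -> S) (F : I -> V) :
  (forall i, B (F i)) -> B (\sum_i c i *: F i).
Proof.
move=> BF; elim/big_ind: _ => [|u v|i _]; first exact: subspace0.
  exact: subspaceD.
exact: subspaceZ.
Qed.

End Subspace.

Section Span.
Variables (S : comNzRingType) (V : formAlg S) (n : nat) (b : n.-tuple V).

Lemma span_of_tnth i : span_of b (tnth b i).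
Proof.
exists (fun j => (j == i)%:R).
rewrite (bigD1 i) //= eqxx scale1r big1 ?addr0 //.
by move=> j /negPf ->; rewrite scale0r.
Qed.

Lemma span_of_mem v : v \in b -> span_of b v.
Proof. by move=> /tnthP[i ->]; exact: span_of_tnth. Qed.

Lemma span_of_subspace : is_subspace (span_of b).
Proof.
split=> [|c _ _ [cu ->] [cv ->]].
  by exists (fun=> 0); rewrite big1 // => i _; rewrite scale0r.
exists (fun i => c * cu i + cv i); rewrite scaler_sumr -big_split.
by apply: eq_bigr => i _; rewrite scalerDl scalerA.
Qed.

Lemma span_of_subalgebra :
  (forall u v, u \in b -> v \in b -> span_of b (amul u v)) ->
  is_subalgebra (span_of b).
Proof.
move=> bM; have [span0 spanP] := span_of_subspace; split=> // _ _ [c ->] [d ->].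
rewrite amulC linear_sum /=; under eq_bigr do rewrite linearZ /= amulC.
apply: (subspace_lincomb span_of_subspace) => i; rewrite linear_sum /=.
under eq_bigr do rewrite linearZ /=.
by apply: (subspace_lincomb span_of_subspace) => j; apply: bM; exact: mem_tnth.
Qed.

Lemma span_of_min (B : set V) :
  is_subspace B -> (forall v, v \in b -> B v) -> span_of b `<=` B.
Proof.
move=> subB bB _ [c ->]; apply: subspace_lincomb => // i.
by apply: bB; exact: mem_tnth.
Qed.

End Span.

Lemma preimage_subalgebra (S S' : comNzRingType) (iota : {rmorphism S -> S'})
    (V : formAlg S) (V' : formAlg S') (f : form_morphism iota V V')
    (B : set V') :
  is_subalgebra B -> is_subalgebra (f @^-1` B).
Proof.
move=> subB; split=> [|c u v Bu Bv|u v Bu Bv]; rewrite /preimage /=.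
- by rewrite linear0; case: subB.
- by rewrite linearP; case: subB => _ + _; apply.
- by rewrite form_morphismM; case: subB => _ _; apply.
Qed.

(** * Symmetries of the multiplication table *)

Section Relabelling.
Variable t : idx.

(** A symmetry of the multiplication table that carries [(true, o0)] to [t]; it
    reduces every axis to [axis0]. *)
Definition relabel (u : idx) : idx := (u.1 == t.1, tperm o0 t.2 u.2).

Lemma relabelK : involutive relabel.
Proof.
by move=> [e i]; rewrite /relabel /= tpermK; case: e; case: (t.1).
Qed.

Lemma relabel0 : relabel (true, o0) = t.
Proof. by rewrite /relabel /= tpermL; case: (t) => -[]. Qed.

Lemma relabel_self : relabel t = (true, o0).
Proof. by rewrite -{1}relabel0 relabelK. Qed.

Lemma relabel_opp u : relabel (opp_idx u) = opp_idx (relabel u).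
Proof. by rewrite /relabel /opp_idx /=; case: (u.1); case: (t.1). Qed.

Lemma relabel_eq2 u v : ((relabel u).2 == (relabel v).2) = (u.2 == v.2).
Proof. exact: (inj_eq perm_inj). Qed.

(** The table depends only on equality of indices, equality of their second components and
    [opp_idx], all of which [relabel] respects. *)
Lemma relabel_table (R : realType) (S : comNzRingType)
    (iota : {rmorphism R -> S}) (V : formAlg S) (b : bidx -> V) :
  has_table4B iota b -> has_table4B iota (b \o omap relabel).
Proof.
move=> tab i j; have [/= -> ->] := tab (omap relabel i) (omap relabel j).
have rel_inj := inv_inj relabelK.
rewrite /gram4B (inj_eq (inj_omap rel_inj)).
by case: i j => [u|] [v|] //=;
  rewrite ?(inj_eq rel_inj) ?relabel_eq2 ?relabel_opp.
Qed.

End Relabelling.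

Lemma opp4BE (R : realType) (x : alg4B R) k : (- x) k = - x k.
Proof. by rewrite ffunE. Qed.

Lemma e4BE (R : realType) (k j : bidx) : e4B R k j = (k == j)%:R.
Proof. by rewrite ffunE. Qed.

(** * Algebras isomorphic to the 7-dimensional one have the defining properties *)

Section Isomorphism.
Variables (R : realType) (S : comNzRingType) (iota : {rmorphism R -> S}).
Variables (V : formAlg S) (f : form_morphism iota (alg4B R) V).
Hypothesis f_bij : bijective f.

Let a (t : idx) : V := f (e4B R (Some t)).
Let rho : V := f (e4B R None).

(** The relabelled family still has the table, hence defines a morphism. It is [f] after an
    involutive permutation of coordinates, hence bijective. *)
Lemma relabelled t : exists2 g : form_morphism iota (alg4B R) V,
  bijective g & forall u, g (e4B R (Some u)) = a (relabel t u).
Proof.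
have tab := relabel_table t (form_morphism_has_table f).
exists (table_morphism tab) => [|u]; last by rewrite table_morphism_e.
pose perm_vec (x : alg4B R) : alg4B R := [ffun k => x (omap (relabel t) k)].
have perm_vecK : involutive perm_vec.
  move=> x; apply/ffunP => k; rewrite !ffunE; congr (x _).
  by case: k => //= u; rewrite relabelK.
suff gE : f \o perm_vec =1 table_morphism tab.
  exact: eq_bij (bij_comp f_bij (inv_bij perm_vecK)) _ gE.
move=> x; rewrite /= [perm_vec x]e4B_sum linear_sum.
have omap_inj := inj_omap (inv_inj (relabelK t)).
rewrite (reindex_inj omap_inj); apply: eq_bigr => k _.
rewrite linearZ /= ffunE; congr (iota (x _) *: _).
by case: k => //= u; rewrite relabelK.
Qed.

Lemma axis_iso t : is_axis iota (a t) /\ is_primitive iota (a t).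
Proof.
have [g g_bij ga] := relabelled t; rewrite -(relabel0 t) -ga.
by split; [exact: axis0_is_axis | exact: axis0_is_primitive].
Qed.

Lemma axes_inj : injective a.
Proof.
move=> s t /(bij_inj f_bij)/ffunP/(_ (Some t)); rewrite !ffunE eqxx.
by case: eqP => [[//]|_ /esym/eqP]; rewrite oner_eq0.
Qed.

Lemma reflect_axis u :
  e4B R (Some u) - proj M32 (e4B R (Some u)) - proj M32 (e4B R (Some u))
  = e4B R (Some (if u.2 == o0 then u else opp_idx u)) :> alg4B R.
Proof.
apply/ffunP; elim/bidx_ind; rewrite !add4BE !opp4BE /proj /eig32 !of_coordsE;
  rewrite /half_diff !e4BE; case: u => -[] i; case: (I3_cases i) => -> /=;
  by field.
Qed.

Lemma propertyP_iso : propertyP iota a.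
Proof.
split; first exact: axes_inj.
move=> s t; have [g g_bij ga] := relabelled s.
(* Both axes are written as images under [g], so that the involution of a_s becomes that of
   [axis0]. *)
rewrite -{1}(relabel0 s) -ga -[t in LHS](relabelK s) -ga.
rewrite (miyamoto_axis0 g_bij) reflect_axis ga; congr a.
have -> : ((relabel s t).2 == o0) = (t.2 == s.2).
  by rewrite -(relabel_eq2 s t s) relabel_self.
by case: ifP => _; rewrite ?relabel_opp relabelK.
Qed.

Lemma frobenius_iso : is_frobenius_form V.
Proof.
split.
  exists rho, rho; rewrite form_morphism_form form_e4B /gram4B eqxx.
  by rewrite rmorph1 oner_eq0.
have [g _ gK] := f_bij => u v w; rewrite -(gK u) -(gK v) -(gK w).
by rewrite -!form_morphismM !form_morphism_form form4B_frobenius.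
Qed.

Lemma rho_axes i : rho =
  a (true, i) + a (false, i) - iota 8 *: amul (a (true, i)) (a (false, i)).
Proof.
have [/= -> _] := form_morphism_has_table f (Some (true, i)) (Some (false, i)).
have iota8 : iota 8 * iota 8^-1 = 1.
  by rewrite -rmorphM mulfV ?pnatr_eq0 ?rmorph1.
by rewrite eqxx scalerA iota8 scale1r subKr.
Qed.

Lemma gen_subalgebra_iso : gen_subalgebra (range a) = setT.
Proof.
apply/seteqP; split=> // v _ B subB aB; have [g _ gK] := f_bij.
have Ba t : B (a t) by apply: aB; exists t.
have spB := subalgebra_subspace subB; have [_ _ BM] := subB.
rewrite -(gK v) [g v]e4B_sum linear_sum; under eq_bigr do rewrite linearZ /=.
apply: subspace_lincomb => // k; case: k => [t|]; first exact: Ba.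
rewrite -/rho (rho_axes o0).
apply: subspaceB => //; first exact: subspaceD.
by apply: subspaceZ => //; exact: BM.
Qed.

(** Places a_-j in the subalgebra generated by a_i and a_j. Here w = a_-i + a_-j - a_rho and 64 a_i
    w = 15 (a_-i - a_rho) + a_i + a_-j - a_j; subtracting this from 15 w leaves 14 a_-j - a_i +
    a_j. *)
Lemma opposite_axis i j : i != j ->
  let ei : alg4B R := e4B R (Some (true, i)) in
  let ej : alg4B R := e4B R (Some (true, j)) in
  let w := ei + ej - 64 *: amul ei ej in
  e4B R (Some (false, j)) = 14^-1 *: (ei - ej + 15 *: w - 64 *: amul ei w).
Proof.
move=> ij ei ej w.
have -> : w = e4B R (Some (false, i)) + e4B R (Some (false, j)) - e4B R None.
  rewrite /w mul_e4B /table4B !xpair_eqE /= (negPf ij).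
  apply/ffunP => k; rewrite !(add4BE, opp4BE, scale4BE, e4BE).
  by rewrite /opp_idx /=; field.
rewrite (raddfB (amul ei)) (raddfD (amul ei)) /= !mul_e4B /table4B.
rewrite !xpair_eqE /= (negPf ij) eqxx /opp_idx /=.
by apply/ffunP => k; rewrite !(add4BE, opp4BE, scale4BE); field.
Qed.

Lemma table4B_subspace (B : set V) (K : pred bidx) i j :
  is_subspace B -> K None -> (forall t, K (Some t) -> K (Some (opp_idx t))) ->
  (forall k, K k -> B (f (e4B R k))) -> K i -> K j ->
  B (table4B iota (f \o e4B R) i j).
Proof.
move=> subB K0 Kopp KB.
have BZ := subspaceZ subB; have BB := subspaceB subB; have BD := subspaceD subB.
by case: i j => [s|] [t|] Ks Kt; rewrite /table4B /=; do ?case: ifP => _;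
  do ?apply: BZ;
  do ?[apply: (BB) | apply: (BD)]; apply: KB => //; exact: Kopp.
Qed.

(** The span is closed under products because its indices include that of a_rho and are stable under
    [opp_idx]. Conversely, [opposite_axis] produces the opposite axes and [rho_axes] then produces
    a_rho. *)
Lemma gen_pair_iso i j : i != j ->
  gen_subalgebra [set a (true, i); a (true, j)] =
  span_of [tuple a (true, i); a (false, i); a (true, j); a (false, j); rho].
Proof.
move=> ij; set b := [tuple _; _; _; _; _]; apply/seteqP; split.
  pose K : seq bidx := [:: Some (true, i); Some (false, i);
    Some (true, j); Some (false, j); None].
  have spb := span_of_subspace b.
  have KB k : k \in K -> span_of b (f (e4B R k)).
    by move=> Kk; apply: span_of_mem; exact: (map_f (f \o e4B R) Kk).
  move=> v; apply; last first.
    by move=> _ [] ->; apply: span_of_mem; rewrite !inE eqxx ?orbT.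
  apply: span_of_subalgebra => u w.
  have bE : b = map (f \o e4B R) K :> seq V by [].
  rewrite -![_ \in b]/(_ \in tval b) !bE => /mapP[k Kk ->] /mapP[l Kl ->].
  have [-> _] := form_morphism_has_table f k l.
  apply: (table4B_subspace (K := mem K)) => // t.
  by rewrite /K /= !inE => /or4P[/eqP[->]|/eqP[->]|/eqP[->]|/orP[/eqP[->]|//]];
    rewrite /opp_idx /= eqxx ?orbT.
move=> v bv B subB aB; have spB := subalgebra_subspace subB.
have opp_in k l :
    k != l -> B (a (true, k)) -> B (a (true, l)) -> B (a (false, l)).
  (* Pulled back along [f], [B] becomes a real subalgebra, to which [opposite_axis] applies. *)
  move=> kl Bk Bl; have subP := preimage_subalgebra f subB.
  have spP := subalgebra_subspace subP; have [_ _ PM] := subP.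
  pose ek : alg4B R := e4B R (Some (true, k)).
  pose el : alg4B R := e4B R (Some (true, l)).
  pose w := ek + el - 64 *: amul ek el.
  have Pk : (f @^-1` B) ek by exact: Bk.
  have Pl : (f @^-1` B) el by exact: Bl.
  suff : (f @^-1` B) (e4B R (Some (false, l))) by [].
  rewrite (opposite_axis kl) -/ek -/el -/w; apply: subspaceZ => //.
  have Pw : (f @^-1` B) w.
    apply: (subspaceB spP); first exact: subspaceD.
    by apply: subspaceZ => //; exact: PM.
  apply: (subspaceB spP); last by apply: subspaceZ => //; exact: PM.
  by apply: (subspaceD spP); [exact: subspaceB | exact: subspaceZ].
have Bi : B (a (true, i)) by apply: aB; left.
have Bj : B (a (true, j)) by apply: aB; right.
have Bi' : B (a (false, i)) by apply: (opp_in j i) => //; rewrite eq_sym.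
have Bj' : B (a (false, j)) by exact: (opp_in i j).
have Brho : B rho by rewrite (rho_axes i); apply: subspaceB => //;
  [exact: subspaceD | apply: subspaceZ => //; case: subB => _ _; apply].
apply: span_of_min bv => // u; rewrite !inE.
by case/or4P => [/eqP->|/eqP->|/eqP->|/orP[]/eqP->].
Qed.

Lemma shape4B_iso : shape4B iota a.
Proof.
move=> i j ij; have tab := form_morphism_has_table f; exists rho; split.
- by have [/= -> _] := tab None None.
- exact: gen_pair_iso.
- move=> e d; have [-> ->] := tab (Some (e, i)) (Some (d, j)).
  rewrite /gram4B /table4B -[Some _ == _]/(_ == _ :> idx) xpair_eqE /=.
  by rewrite (negPf ij) andbF.
- move=> k _; split=> [||e].
  + by have [/= -> _] := tab (Some (true, k)) (Some (false, k)); rewrite eqxx.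
  + have [_ ->] := tab (Some (true, k)) (Some (false, k)).
    by rewrite /gram4B /= eqxx.
  + by have [/= -> ->] := tab (Some (e, k)) None.
- by have [_ ->] := tab None None; rewrite /gram4B eqxx rmorph1.
Qed.

End Isomorphism.

(** * The table in a member of the class *)

(** The values of the form that the shape does not prescribe, those of
    <a_-i, a_i> and <a_rho, a>, satisfy this equation because the form is
    Frobenius and the axes are idempotent. *)
Lemma fixpoint_eighth (R : realType) (S : comNzRingType)
    (iota : {rmorphism R -> S}) y :
  y = iota 8^-1 * (1 + y - iota 8^-1) -> y = iota 8^-1.
Proof.
move=> fix_y; apply/eqP; rewrite -subr_eq0 -[y - _]mul1r.
(* The equation says that 7/8 (y - 1/8) = 0; as [S] is only a ring, 7/8 is inverted in the reals. *)
have -> : 1 = iota (8 / 7) * (1 - iota 8^-1).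
  rewrite -{2}(rmorph1 iota) -rmorphB -rmorphM -[LHS](rmorph1 iota).
  by congr (iota _); field.
have -> : iota (8 / 7) * (1 - iota 8^-1) * (y - iota 8^-1) =
    iota (8 / 7) * (y - iota 8^-1 * (1 + y - iota 8^-1)) by ring.
by rewrite -fix_y subrr mulr0.
Qed.

Section TableOfShape.
Variables (R : realType) (S : comNzRingType) (iota : {rmorphism R -> S}).
Variables (V : formAlg S) (a : idx -> V).
Hypothesis axial : is_primitive_frobenius_axial iota a.
Hypothesis shape : shape4B iota a.

Definition rho_of (i : 'I_3) : V :=
  a (true, i) + a (false, i) - iota 8 *: amul (a (true, i)) (a (false, i)).

Lemma rho_of_shape i (rho : V) :
  amul (a (true, i)) (a (false, i)) =
    iota 8^-1 *: (a (true, i) + a (false, i) - rho) ->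
  rho = rho_of i.
Proof.
move=> def_rho; rewrite /rho_of def_rho scalerA.
have -> : iota 8 * iota 8^-1 = 1 by rewrite -rmorphM mulfV ?pnatr_eq0 ?rmorph1.
by rewrite scale1r subKr.
Qed.

(** The idempotent of the subalgebra for i and j is recovered from either pair of opposite axes. *)
Lemma rho_of_eq i j : rho_of i = rho_of j.
Proof.
have [->//|ij] := eqVneq i j.
have [rho [_ _ _ rhoE _]] := shape ij.
have [/rho_of_shape <- _ _] := rhoE i (or_introl erefl).
by have [/rho_of_shape <- _ _] := rhoE j (or_intror erefl).
Qed.

Definition basis_of_shape (k : bidx) : V :=
  if k is Some t then a t else rho_of o0.

Local Notation b := basis_of_shape.

(** The shape speaks of pairs only, so facts about one index are read off from a pair containing
    it. *)
Lemma exists_neq (i : 'I_3) : exists j, i != j.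
Proof. by case: (I3_cases i) => ->; [exists o1 | exists o0 | exists o0]. Qed.

Lemma shape_rho i :
  [/\ amul (b None) (b None) = b None, aform (b None) (b None) = 1,
      amul (a (true, i)) (a (false, i))
        = iota 8^-1 *: (a (true, i) + a (false, i) - b None),
      aform (a (true, i)) (a (false, i)) = iota 8^-1
    & forall e, amul (a (e, i)) (b None)
                  = iota 8^-1 *: (a (e, i) + b None - a (~~ e, i))
             /\ aform (a (e, i)) (b None) = iota 8^-1].
Proof.
have [j ij] := exists_neq i; have [rho [rho2 _ _ rhoE form_rho]] := shape ij.
have [mul_i form_i mul_rho] := rhoE i (or_introl erefl).
by have <- : rho = b None by rewrite /= (rho_of_eq o0 i); exact: rho_of_shape.
Qed.

Lemma shape_neq e d i j : i != j ->
  amul (a (e, i)) (a (d, j)) = iota 64^-1 *: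
    (a (e, i) + a (d, j) - a (~~ e, i) - a (~~ d, j) + b None)
  /\ aform (a (e, i)) (a (d, j)) = iota 64^-1.
Proof.
move=> ij; have [rho [_ _ mul_ij rhoE _]] := shape ij.
have [mul_i _ _] := rhoE i (or_introl erefl).
by have <- : rho = b None by rewrite /= (rho_of_eq o0 i); exact: rho_of_shape.
Qed.

Lemma shape_has_table : has_table4B iota b.
Proof.
have [axes _ [_ frob] norm] := axial.
have idem t : amul (a t) (a t) = a t by have [[]] := axes t.
(* The shape gives this value in the other order. Expanding a_-i as its own square and moving one
   factor across yields the equation of [fixpoint_eighth]. *)
have form_opp i : aform (a (false, i)) (a (true, i)) = iota 8^-1.
  have [_ _ mul_i _ /(_ false) [_ form_rho]] := shape_rho i.
  apply: fixpoint_eighth; rewrite -[in LHS](idem (false, i)) -frob amulC mul_i.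
  rewrite linearZ /= -[X in aform _ (X - _)]addrC linearB linearD /=.
  by rewrite norm form_rho.
(* The same device, with a_t written as its own square. *)
have form_rho t : aform (b None) (a t) = iota 8^-1.
  case: t => e i; have [_ _ _ form_i mul_rho] := shape_rho i.
  apply: fixpoint_eighth; have [mul_e form_e] := mul_rho e.
  rewrite -[in LHS](idem (e, i)) frob (amulC (b None)) mul_e.
  rewrite -[aform _ _ in LHS]/(aform_op _ _) linearZ linearB linearD /=.
  rewrite /aform_op.
  by rewrite norm; case: (e); rewrite ?form_opp ?form_i.
move=> [[e i]|] [[d j]|] /=.
- rewrite xpair_eqE /gram4B -[Some _ == _]/(_ == _ :> idx) xpair_eqE /=.
  have [<-|ij] := eqVneq i j; last first.
    by rewrite andbF; exact: shape_neq.
  have [_ _ mul_i form_i _] := shape_rho i; rewrite andbT.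
  have [<-|] := eqVneq e d; first by rewrite idem norm rmorph1.
  case: e d => -[] // _; rewrite ?form_opp ?form_i; split=> //.
  by rewrite amulC mul_i [a (true, i) + _]addrC.
- have [_ _ _ _ /(_ e) [-> ->]] := shape_rho i; split=> //.
- have [_ _ _ _ /(_ d) [mul_d _]] := shape_rho j.
  by rewrite amulC mul_d form_rho.
- have [-> -> _ _ _] := shape_rho o0; by rewrite /gram4B eqxx rmorph1.
Qed.

End TableOfShape.

(** * The universal member of the class *)

Section Universality.
Variable R : realType.

Definition axes4B (t : idx) : alg4B R := e4B R (Some t).

Lemma iso_in_C4B (p : ideal_pair (Mhat R))
    (f : form_morphism (iotaq p) (alg4B R) (quot_alg p)) :
  bijective f -> (forall t, f (axes4B t) = gen p t) -> in_C4B p.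
Proof.
move=> f_bij fa.
have genE : gen p = fun t => f (axes4B t) by apply/funext => t; rewrite fa.
rewrite /in_C4B genE; split; [split| |].
- by move=> t; exact: axis_iso.
- exact: gen_subalgebra_iso.
- exact: frobenius_iso f_bij.
- by move=> t; rewrite form_morphism_form form_e4B /gram4B eqxx rmorph1.
- exact: propertyP_iso.
- exact: shape4B_iso.
Qed.

Lemma in_C4B_morphism (q : ideal_pair (Mhat R)) : in_C4B q ->
  exists f : form_morphism (iotaq q) (alg4B R) (quot_alg q),
    forall t, f (axes4B t) = gen q t.
Proof.
move=> [axial _ shape].
exists (table_morphism (shape_has_table axial shape)) => t.
by rewrite table_morphism_e.
Qed.

Lemma axes4B_generate : gen_subalgebra (range axes4B) = setT.
Proof.
pose id4B : form_morphism idfun (alg4B R) (alg4B R) :=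
  @FormMorphism _ _ idfun (alg4B R) (alg4B R) id (fun _ _ _ => erefl)
    (fun _ _ => erefl) (fun _ _ => erefl).
exact: (@gen_subalgebra_iso _ _ _ _ id4B (inv_bij (fun=> erefl))).
Qed.

Definition pair4B : ideal_pair (Mhat R) :=
  ker_pair axes4B (@form4B_frobenius R).

Lemma pair4B_in_C4B : in_C4B pair4B.
Proof.
have fa := @ker_morphism_gen _ _ _ (@form4B_frobenius R) axes4B_generate.
apply: iso_in_C4B (fa).
by apply: (form_morphism_bij (frobW := @form4B_frobenius R) axes4B_generate fa).
Qed.

Lemma pair4B_universal : is_universal_4B pair4B.
Proof.
split=> [|q /in_C4B_morphism[f fa]]; first exact: pair4B_in_C4B.
exact: (ker_pair_min _ fa).
Qed.

(** Since [pair4B] is in the class, minimality of [p] puts [idI p] inside the kernel of the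
    evaluation, which makes [f] injective. *)
Lemma universal_iso (p : ideal_pair (Mhat R)) : is_universal_4B p ->
  exists f : form_morphism (iotaq p) (alg4B R) (quot_alg p),
    [/\ bijective f, forall t, f (axes4B t) = gen p t & bijective (iotaq p)].
Proof.
move=> [/in_C4B_morphism[f fa] /(_ _ pair4B_in_C4B)[subI _]].
exists f; split=> //; last exact: (iotaq_bij (@form4B_frobenius R) fa).
exact: (form_morphism_bij axes4B_generate fa subI).
Qed.

Lemma iso_is_basis (S : comNzRingType) (iota : {rmorphism R -> S})
    (V : formAlg S) (f : form_morphism iota (alg4B R) V) :
  bijective f -> bijective iota ->
  let a e i := f (axes4B (e, i)) in
  is_basis [tuple a true o0; a false o0; a true o1; a false o1;
                  a true o2; a false o2; f (e4B R None)].
Proof.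
move=> f_bij iota_bij a; have [g fK gK] := f_bij.
have [h iotaK hK] := iota_bij.
pose coords (x : alg4B R) := [:: x (Some (true, o0)); x (Some (false, o0));
  x (Some (true, o1)); x (Some (false, o1)); x (Some (true, o2));
  x (Some (false, o2)); x None].
have fE x : f x = \sum_(k < 7) iota (nth 0 (coords x) k) *: tnth
    [tuple a true o0; a false o0; a true o1; a false o1; a true o2; a false o2;
           f (e4B R None)] k.
  rewrite {1}[x]e4B_sum linear_sum; under eq_bigr do rewrite linearZ.
  (* Reorders the terms of [sum_bidx] into the order of the tuple, where opposite axes are adjacent
     and a_rho is last. *)
  rewrite sum_bidx (AC (1 * 3 * 3) (2 * 5 * 3 * 6 * 4 * 7 * 1)).
  by rewrite !big_ord_recl big_ord0 addr0 !addrA.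
split.
  apply/seteqP; split=> // v _.
  by exists (fun k => iota (nth 0 (coords (g v)) k)); rewrite -fE gK.
(* The coefficients are pulled back to the reals; [of_coords] takes the coordinate of a_rho first,
   hence the index 6. *)
move=> c; pose x := of_coords (h (c (inord 6))) (h (c (inord 0)))
  (h (c (inord 1))) (h (c (inord 2))) (h (c (inord 3)))
  (h (c (inord 4))) (h (c (inord 5))).
have cE k : c k = iota (nth 0 (coords x) k).
  rewrite /coords !of_coordsE /= -[k in LHS]inord_val.
  by case: k => [[|[|[|[|[|[|[|//]]]]]]] ?]; rewrite /= hK.
under eq_bigr do rewrite cE; rewrite -fE -(linear0 f) => /(bij_inj f_bij) x0 k.
rewrite cE x0 /coords !ffunE.
by case: k => [[|[|[|[|[|[|[|//]]]]]]] ?]; rewrite /= rmorph0.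
Qed.

End Universality.

Theorem theorem4p1 (R : realType) :
  (exists p : ideal_pair (Mhat R), is_universal_4B p) /\
  forall p : ideal_pair (Mhat R), is_universal_4B p ->
    let a (e : bool) (i : 'I_3) : quot_alg p := gen p (e, i) in
    let i1 : 'I_3 := inord 0 in
    let i2 : 'I_3 := inord 1 in
    let i3 : 'I_3 := inord 2 in
    let arho : quot_alg p :=
      a true i1 + a false i1 - 8 *: amul (a true i1) (a false i1) in
    is_basis [tuple a true i1; a false i1; a true i2; a false i2;
                    a true i3; a false i3; arho] /\
    bijective (iotaq p).
Proof.
split=> [|p /universal_iso[f [f_bij fa iota_bij]]].
  by exists (pair4B R); exact: pair4B_universal.
move=> a i1 i2 i3 arho; split=> //.
have [i1E i2E i3E] : [/\ i1 = o0, i2 = o1 & i3 = o2].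
  by split; apply: val_inj; rewrite /= inordK.
(* The scalar 8 in [arho] lies in the coefficient ring of the quotient; it is the image of the real
   8. *)
have -> : arho = f (e4B R None).
  by rewrite (rho_axes f o0) (rmorph_nat (iotaq p) 8) /arho i1E /a -!fa.
by rewrite i1E i2E i3E /a -!fa; exact: iso_is_basis.
Qed.
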